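(* Let $X$ be a nonempty compact metrizable space of finite topological dimension $n$, let $T:X\to X$ be a homeomorphism, and let $d\ge1$ be an integer. If $\mathrm{perdim}(X,T)<\frac d2$, then the dynamical system $(X,T)$ embeds in the shift $(([0,1]^d)^{\mathbb{Z}},\sigma)$.
   Context: Topological dimension: for a finite open cover $\alpha$ of a space $Y$, $\mathrm{ord}(\alpha)=\sup_{y\in Y}\left(\sum_{U\in\alpha}\mathbf 1_U(y)\right)-1$; a cover $\beta$ refines $\alpha$ (written $\beta\succ\alpha$) if each element of $\beta$ is contained in some element of $\alpha$; $D(\alpha)=\min_{\beta\succ\alpha}\mathrm{ord}(\beta)$, over finite open covers $\beta$ of $Y$; and $\dim(Y)=\sup_\alpha D(\alpha)$ over finite open covers $\alpha$ of $Y$. Convention: $\dim(\emptyset)=0$. For an integer $k\ge1$, $P_k$ is the set of periodic points of $(X,T)$ of (minimal) period at most $k$. The periodic dimension is $\mathrm{perdim}(X,T)=\sup_{k\ge1}\frac{\dim(P_k)}{k}$. $\sigma$ is the bilateral shift $(x_i)_{i\in\mathbb{Z}}\mapsto(x_{i+1})_{i\in\mathbb{Z}}$ on $([0,1]^d)^{\mathbb{Z}}$ (product topology). A system $(X,T)$ embeds in $(Y,S)$ if there is a map $\phi:X\to Y$ that is a homeomorphism onto its image and satisfies $\phi\circ T=S\circ\phi$. *)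

(* Defs.v *)
From mathcomp Require Import all_boot all_order all_algebra.
From mathcomp Require Import all_classical all_reals all_analysis.

Set Implicit Arguments.
Unset Strict Implicit.
Unset Printing Implicit Defensive.

Import Order.TTheory GRing.Theory Num.Theory.
Import numFieldNormedType.Exports.

Local Open Scope classical_set_scope.
Local Open Scope ring_scope.

(* The topology of X is induced by a metric; nonnegativity of the metric
   follows from the three axioms below. *)
Definition metrizable (R : realType) (X : topologicalType) : Prop :=
  exists d : X -> X -> R,
    [/\ forall x y, d x y = 0 <-> x = y,
        forall x y, d x y = d y x,
        forall x y z, d x z <= d x y + d y z &
        forall A : set X, open A <->
          forall x, A x -> exists2 e : R, 0 < e & [set y | d x y < e] `<=` A].

Definition homeomorphism (X Y : topologicalType) (f : X -> Y) : Prop :=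
  continuous f /\
  exists g : Y -> X, [/\ continuous g, cancel f g & cancel g f].

Definition corestriction (X : Type) (Y : Type) (f : X -> Y) (x : X) :
  set_type (range f) := exist _ (f x) (mem_set (imageT f x)).

(* [set_type (range f)] carries the topology induced from Y. *)
Definition homeomorphism_onto_image (X Y : topologicalType) (f : X -> Y) :
  Prop := homeomorphism (corestriction f).

Definition embeds (X : topologicalType) (T : X -> X)
    (Y : topologicalType) (S : Y -> Y) : Prop :=
  exists phi : X -> Y,
    homeomorphism_onto_image phi /\ (forall x, phi (T x) = S (phi x)).

Section dimension.
Context (R : realType) (Y : topologicalType).

Definition finite_open_cover (a : set (set Y)) : Prop :=
  [/\ finite_set a, (forall U, a U -> open U) & \bigcup_(U in a) U = setT].

Definition refines (b a : set (set Y)) : Prop :=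
  forall V, b V -> exists2 U, a U & V `<=` U.

Definition cover_ord (a : set (set Y)) : \bar R :=
  (ereal_sup (range (fun y : Y => (\sum_(U \in a) (\1_U y : R))%:E)) - 1)%E.

(* The orders of covers of a nonempty Y are natural numbers, so that this
   infimum is a minimum. *)
Definition cover_dim (a : set (set Y)) : \bar R :=
  ereal_inf [set cover_ord b | b in
               [set b | finite_open_cover b /\ refines b a]].

Definition top_dim : \bar R :=
  if `[< [set: Y] = set0 >] then 0%E
  else ereal_sup [set cover_dim a | a in [set a | finite_open_cover a]].

End dimension.

Definition minimal_period (X : Type) (T : X -> X) (x : X) (p : nat) : Prop :=
  [/\ (0 < p)%N, iter p T x = x &
      forall j : nat, (0 < j < p)%N -> iter j T x <> x].

Definition periodic_points (X : Type) (T : X -> X) (k : nat) : set X :=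
  [set x | exists2 p : nat, (p <= k)%N & minimal_period T x p].

(* [set_type] carries the subspace topology, unlike the library's [subspace],
   which keeps all the points of X. *)
Definition perdim (R : realType) (X : topologicalType) (T : X -> X) : \bar R :=
  ereal_sup [set (top_dim R (set_type (periodic_points T k)) /
                    (k%:R : R)%:E)%E | k in [set k : nat | (0 < k)%N]].

Definition cube (R : realType) (d : nat) : topologicalType :=
  {ptws 'I_d -> set_type (`[0, 1]%classic : set R)}.

Definition cube_sequences (R : realType) (d : nat) : topologicalType :=
  {ptws int -> cube R d}.

Definition cube_shift (R : realType) (d : nat) (x : cube_sequences R d) :
  cube_sequences R d := fun i : int => x (i + 1).

Arguments cube_shift : clear implicits.

(* Main.v *)
Require Import Defs.
From mathcomp Require Import all_boot all_order all_algebra.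
From mathcomp Require Import all_classical all_reals all_analysis.
From mathcomp Require Import zify lra.

(** Write [f : X -> R^d] and let [I_f x] be the sequence of the [f (T^i x)].
    By a Baire argument it suffices to cover the off-diagonal pairs of points
    by countably many compact sets [K] such that every continuous [f] has
    arbitrarily small perturbations [g] for which [I_g] separates all the pairs
    in [K]; a function separating every pair is then squashed into the cube.

    Near a pair [(x, y)] whose orbit segments are disjoint, the values of [f]
    along the segments can be prescribed freely, so that one may replace them by
    maps into polyhedra in general position, through the nerves of fine covers.
    With [N = 2n + 1], points of period [p < 2N] count as segments of length
    [p] whose base set has dimension less than [p d / 2], all other points as
    segments of length [N] or [2N] whose base set has dimension [n < N d / 2].
    Two segments of lengths [P <= Q] are compared in [R^(Q d)], where the
    dimensions of the two polyhedra add up to less than [Q d].  When [y = T^j x],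
    equality of the two sequences confines the segment of [x] to a linear
    subspace of dimension at most half of that of the ambient space, which the
    polyhedron misses for the same reason. *)

Set Implicit Arguments.
Unset Strict Implicit.
Unset Printing Implicit Defensive.

Import Order.TTheory GRing.Theory Num.Theory.
Import numFieldNormedType.Exports.

Local Open Scope classical_set_scope.
Local Open Scope ring_scope.

(** * General position *)

(** A nonzero polynomial has fewer roots than its size, so it cannot vanish at all of the [size p]
    distinct points [eps / k.+1%:R]. *)
Lemma nonroot_near0 (R : realFieldType) (p : {poly R}) (eps : R) :
  p != 0 -> 0 < eps -> exists t, [/\ 0 < t, t <= eps & ~~ root p t].
Proof.
move=> p0 e0; pose rs := [seq eps / k.+1%:R | k <- iota 0 (size p)].
have rs_uniq : uniq rs.
  rewrite map_inj_uniq ?iota_uniq // => a b.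
  move=> /(mulfI (lt0r_neq0 e0)) /invr_inj /eqP.
  by rewrite eqr_nat => /eqP[].
have /allPn[t /mapP[k _ ->] nr] : ~~ all (root p) rs.
  apply/negP => h; have := max_poly_roots p0 h rs_uniq.
  by rewrite size_map size_iota ltnn.
exists (eps / k.+1%:R); split=> //; first by rewrite divr_gt0.
by rewrite ler_pdivrMr// ler_peMr ?ler1n// ltW.
Qed.

Lemma rank_lt_annihilator (R : fieldType) (n : nat) (M : 'M[R]_n) :
  (\rank M < n)%N -> exists2 c : 'cV[R]_n, c != 0 & M *m c = 0.
Proof.
move=> rM; have : cokermx M != 0.
  by rewrite -mxrank_eq0 mxrank_coker subn_eq0 -ltnNge.
move=> h; have /existsP[j cj] : [exists j, col j (cokermx M) != 0].
  apply: contraNT h => /existsPn h; apply/eqP/matrixP => i j.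
  have /negPn/eqP/matrixP/(_ i 0) := h j.
  by rewrite !mxE.
by exists (col j (cokermx M)) => //; rewrite colE mulmxA mulmx_coker mul0mx.
Qed.

(** Homogeneous coordinates: an affine subspace of dimension [r] becomes a row space of rank
    [r + 1], and lying in it becomes [<=] between row spaces. *)
Definition homog (R : pzRingType) (D : nat) (v : 'rV[R]_D) : 'rV[R]_(1 + D) :=
  row_mx 1%:M v.

(* The moment curve [t |-> v0 + (t, t^2, ..., t^D)] meets each affine
   hyperplane only finitely often. *)
Lemma avoid_subspaces (R : realFieldType) (D : nat) (Ms : seq 'M[R]_(1 + D))
    (v0 : 'rV[R]_D) (eps : R) :
  0 < eps -> (forall M, M \in Ms -> (\rank M <= D)%N) ->
  exists2 v : 'rV[R]_D, forall c, `|v 0 c - v0 0 c| <= eps &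
    forall M, M \in Ms -> ~~ (homog v <= M)%MS.
Proof.
move=> e0 rMs.
pose w (t : R) : 'rV[R]_D := \row_j (v0 0 j + t ^+ j.+1).
have key M : M \in Ms -> exists2 q : {poly R}, q != 0 &
    forall t, (homog (w t) <= M)%MS -> root q t.
  move=> /rMs rM; have [c c0 Mc] := @rank_lt_annihilator _ (1 + D) M rM.
  (* This is the linear form [c] along the curve. Its coefficients of positive degree are the later
     entries of [c], so [q = 0] would force [c = 0]. *)
  pose q : {poly R} := (c (lshift D 0) 0)%:P
    + \sum_j c (rshift 1 j) 0 *: ((v0 0 j)%:P + 'X^(j.+1)).
  have qS (j : 'I_D) : q`_j.+1 = c (rshift 1 j) 0.
    rewrite /q coefD coefC /= add0r coef_sum (bigD1 j) //= big1 ?addr0.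
      by rewrite coefZ coefD coefC coefXn eqxx /= add0r mulr1.
    move=> k kj; rewrite coefZ coefD coefC coefXn /= eqSS add0r.
    by rewrite -val_eqE /= in kj; rewrite eq_sym (negbTE kj) mulr0.
  exists q.
    apply: contraNneq c0 => q0; apply/eqP.
    have cr j : c (rshift 1 j) 0 = 0 by rewrite -qS q0 coef0.
    have cl : c (lshift D 0) 0 = 0.
      have := congr1 (fun p : {poly R} => p`_0) q0.
      rewrite /q big1 ?addr0 ?coefC ?coef0 // => j _.
      by rewrite cr scale0r.
    apply/matrixP => i j; rewrite !mxE (ord1 j).
    by case: (split_ordP i) => k ->; rewrite ?(ord1 k).
  move=> t /submxP[u wu]; apply/rootP.
  have : (homog (w t) *m c) 0 0 = 0 by rewrite wu -mulmxA Mc mulmx0 mxE.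
  rewrite mxE big_split_ord /= big_ord1 row_mxEl mxE eqxx mul1r => <-.
  rewrite /q hornerD hornerC horner_sum; congr (_ + _).
  apply: eq_bigr => j _; rewrite row_mxEr mxE hornerZ hornerD hornerC hornerXn.
  by rewrite mulrC.
have [q q0 Hq] : exists2 q : {poly R}, q != 0 &
    forall t M, M \in Ms -> (homog (w t) <= M)%MS -> root q t.
  elim: Ms {rMs} key => [|M Ms IH] key; first by exists 1; rewrite ?oner_neq0.
  have [|q q0 Hq] := IH.
    by move=> M' M'M; apply: key; rewrite inE M'M orbT.
  have [q' q'0 Hq'] := key M (mem_head _ _).
  exists (q * q'); first by rewrite mulf_neq0.
  move=> t M'; rewrite inE rootM => /orP[/eqP ->|M'M] h.
    by rewrite Hq' ?orbT.
  by rewrite (Hq t M').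
(* With [t <= 1] every power [t ^+ j.+1] is at most [t], hence at most [eps]. *)
have e'0 : 0 < Num.min eps 1 by rewrite lt_min e0 ltr01.
have [t [t0 te tq]] := nonroot_near0 q0 e'0.
exists (w t); last by move=> M MMs; apply: contra tq; apply: Hq.
move=> c; rewrite mxE addrC addKr ger0_norm ?exprn_ge0 ?(ltW t0)//.
move: te; rewrite le_min => /andP[te t1].
by apply: le_trans te; rewrite -[leRHS]expr1 ler_wiXn2l ?(ltW t0).
Qed.

Lemma mxrank_sum_leq (R : fieldType) (n : nat) (I : finType) (P : pred I)
    (A : I -> 'M[R]_n) :
  (\rank (\sum_(i | P i) A i)%MS <= \sum_(i | P i) \rank (A i))%N.
Proof.
elim/big_rec2: _ => [|i k B _ h]; first by rewrite mxrank0.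
by apply: leq_trans (mxrank_adds_leqif _ _) _; rewrite leq_add2l.
Qed.

(** The points are chosen one by one. Each new one avoids the span of every [M] together with any
    [m] or fewer earlier points, a space of rank at most [r + m <= D]. *)
Lemma general_position (R : realFieldType) (D r m n : nat)
    (Ms : seq 'M[R]_(1 + D)) (v0 : nat -> 'rV[R]_D) (eps : R) :
  0 < eps -> (forall M, M \in Ms -> (\rank M <= r)%N) -> (r + m <= D)%N ->
  exists2 v : nat -> 'rV[R]_D,
    forall i c, (i < n)%N -> `|v i 0 c - v0 i 0 c| <= eps &
    forall (a : nat -> R) M, M \in Ms ->
      (\sum_(i < n) (a i != 0%R) <= m.+1)%N ->
      ((\sum_(i < n) a i *: homog (v i))%R <= M)%MS ->
      forall i, (i < n)%N -> a i = 0.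
Proof.
move=> e0 rM rmD; elim: n => [|n [v vv0 vP]].
  by exists v0 => // i c; rewrite ltn0.
pose Sp (J : {set 'I_n}) (M : 'M[R]_(1 + D)) : 'M[R]_(1 + D) :=
  (M + \sum_(i in J) <<homog (v i)>>)%MS.
pose Ns := [seq Sp J M | M <- Ms, J <- enum [pred J : {set 'I_n} | (#|J| <= m)%N]].
have [_ /allpairsP[[M J] [/= MMs + ->]]|w wv0 wN] :=
    @avoid_subspaces _ _ Ns (v0 n) eps e0.
  rewrite mem_enum inE => Jm.
  apply: leq_trans (mxrank_adds_leqif _ _) _.
  apply: leq_trans rmD; apply: leq_add (rM _ MMs) _.
  apply: leq_trans (mxrank_sum_leq _ _) (leq_trans _ Jm).
  rewrite -sum1_card; apply: leq_sum => i _.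
  by rewrite genmxE rank_leq_row.
exists (fun i => if i == n then w else v i).
  move=> i c; rewrite ltnS leq_eqVlt.
  by have [->|_] := eqVneq i n => //=; apply: vv0.
move=> a M MMs.
rewrite !big_ord_recr /= eqxx => am aM.
have eqs : \sum_(i < n) a i *: homog (if (i : nat) == n then w else v i)
   = \sum_(i < n) a i *: homog (v i) :> 'rV_(1 + D).
  by apply: eq_bigr => i _; rewrite ltn_eqF.
rewrite eqs in aM.
(* Otherwise at most [m] earlier coefficients are nonzero, and solving for the last point puts it in
   a subspace that it avoids. *)
have an0 : a n = 0.
  apply/eqP/negP => /negP an0; rewrite an0 addn1 ltnS in am.
  pose J : {set _} := [set i : 'I_n | a i != 0%R]%SET.
  have Jm : (#|J| <= m)%N.
    apply: leq_trans am; rewrite -sum1_card big_mkcond /=.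
    by apply: leq_sum => i _; rewrite inE; case: (_ != _).
  have /wN /negP : Sp J M \in Ns.
    by apply/allpairsP; exists (M, J); split; rewrite //= mem_enum inE.
  apply.
  rewrite -(eqmx_scale _ an0).
  rewrite -[X in (X <= _)%MS](addKr (\sum_(i < n) a i *: homog (v i)) (a n *: _)).
  rewrite addmx_sub //; last exact: submx_trans aM (addsmxSl _ _).
  rewrite eqmx_opp; apply: summx_sub => i _.
  have [->|ai] := eqVneq (a i) 0; first by rewrite scale0r sub0mx.
  apply: scalemx_sub; apply: submx_trans (addsmxSr _ _).
  by apply: (sumsmx_sup i); rewrite ?inE // genmxE.
rewrite an0 eqxx addn0 scale0r addr0 in am aM.
move=> i; rewrite ltnS leq_eqVlt => /orP[/eqP -> //|]; exact: vP MMs am aM i.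
Qed.

(** * Compact metrizable spaces *)

(** If [Q K] fails, the sets [A] with [Q (K \ A)] form a proper filter containing [K]; the local
    hypothesis at a cluster point of it gives a contradiction. *)
Lemma compact_induction (Y : topologicalType) (K : set Y) (Q : set Y -> Prop) :
  Q set0 -> (forall A B, A `<=` B -> Q B -> Q A) ->
  (forall A B, Q A -> Q B -> Q (A `|` B)) ->
  (forall y, K y -> exists2 U, nbhs y U & Q (U `&` K)) ->
  compact K -> Q K.
Proof.
move=> Q0 Qsub QU Qloc Kco; apply: contrapT => nQK.
pose F : set_system Y := fun A => Q (K `\` A).
have FF : ProperFilter F.
  split; first by rewrite /F setD0.
  split.
  - by rewrite /F setDT.
  - by move=> A B FA FB; rewrite /F setDIr; apply: QU.
  - by move=> A B AB; apply: Qsub; apply: setDS.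
have FK : F K by rewrite /F setDv.
have [y [Ky Fy]] := Kco F FF FK.
have [U Uy QUK] := Qloc y Ky.
have FU : F (~` U) by apply: Qsub QUK => z [Kz /contrapT Uz].
by have [z []] := Fy _ _ FU Uy.
Qed.

(** The condition inside [metrizable], stated for a given metric so that one metric can be fixed
    throughout. *)
Definition metric_inducing (R : realType) (X : topologicalType)
    (rho : X -> X -> R) : Prop :=
  [/\ forall x y, rho x y = 0 <-> x = y,
      forall x y, rho x y = rho y x,
      forall x y z, rho x z <= rho x y + rho y z &
      forall A : set X, open A <->
        forall x, A x -> exists2 e : R, 0 < e & [set y | rho x y < e] `<=` A].

Section metric.
Context (R : realType) (X : topologicalType) (rho : X -> X -> R).
Context (rho_metric : metric_inducing rho).

Lemma rho_eq0 x y : rho x y = 0 <-> x = y. Proof. by case: rho_metric. Qed.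
Lemma rho_xx x : rho x x = 0. Proof. exact/rho_eq0. Qed.
Lemma rho_sym x y : rho x y = rho y x. Proof. by case: rho_metric. Qed.
Lemma rho_triangle x y z : rho x z <= rho x y + rho y z.
Proof. by case: rho_metric. Qed.

Lemma rho_ge0 x y : 0 <= rho x y.
Proof.
have := rho_triangle x y x; rewrite rho_xx (rho_sym y x) -mulr2n.
by rewrite pmulrn_lge0.
Qed.

Lemma rho_gt0 x y : x <> y -> 0 < rho x y.
Proof.
by move=> xy; rewrite lt0r rho_ge0 andbT; apply/eqP => /rho_eq0.
Qed.

Lemma nbhs_rho_ball x e : 0 < e -> nbhs x [set y | rho x y < e].
Proof.
move=> e0; apply: open_nbhs_nbhs; split; last by rewrite /= rho_xx.
have [_ _ _ H] := rho_metric; apply/H => y /= xy.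
exists (e - rho x y); first by rewrite subr_gt0.
by move=> z /= yz; rewrite (le_lt_trans (rho_triangle x y z))// -ltrBrDl.
Qed.

Lemma nbhs_rhoP x (A : set X) :
  nbhs x A <-> exists2 e, 0 < e & [set y | rho x y < e] `<=` A.
Proof.
split=> [|[e e0 sA]]; last exact: filterS sA (nbhs_rho_ball x e0).
rewrite nbhsE => -[B [oB Bx] BA].
have [_ _ _ H] := rho_metric; have [e e0 eB] := (H B).1 oB x Bx.
by exists e => //; apply: subset_trans BA.
Qed.

Lemma lipschitz_continuous (h : X -> R) :
  (forall x y, h x - h y <= rho x y) -> continuous h.
Proof.
move=> hL x; apply/cvgrPdist_lt => e e0.
apply/nbhs_rhoP; exists e => // y /= xy.
apply: le_lt_trans xy; rewrite ler_norml hL andbT lerNl opprB.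
by rewrite rho_sym.
Qed.

Lemma rho_continuous : continuous (fun z : X * X => rho z.1 z.2).
Proof.
move=> [x y]; apply/cvgrPdist_lt => e e0 /=.
have e20 : 0 < e / 2 by rewrite divr_gt0.
exists ([set x' | rho x x' < e / 2], [set y' | rho y y' < e / 2]).
  by split; apply: nbhs_rho_ball.
move=> [x' y'] [/= xx' yy'].
have := rho_triangle x x' y; have := rho_triangle x' y' y.
have := rho_triangle x' x y'; have := rho_triangle x y y'.
rewrite (rho_sym x' x) (rho_sym y' y) ltr_norml => *; apply/andP; split; lra.
Qed.

(* Truncating at 1 gives the empty set the distance 1 instead of the junk
   value of an infimum over the empty set. *)
Definition set_dist (C : set X) (x : X) : R := inf (1 |` (rho x @` C)).

Lemma set_dist_lbound C x : lbound (1 |` (rho x @` C)) 0.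
Proof. by move=> _ [->|[y _ <-]]; rewrite ?rho_ge0. Qed.

Lemma set_dist_has_inf C x : has_inf (1 |` (rho x @` C)).
Proof. by split; [exists 1; left | exists 0; exact: set_dist_lbound]. Qed.

Lemma set_dist_ge0 C x : 0 <= set_dist C x.
Proof.
by apply: lb_le_inf; [exists 1; left | exact: set_dist_lbound].
Qed.

Lemma set_dist_continuous C : continuous (set_dist C).
Proof.
apply: lipschitz_continuous => x y; rewrite lerBlDr -lerBlDl.
apply: lb_le_inf; first by exists 1; left.
move=> _ [->|[z Cz <-]]; rewrite lerBlDl.
  rewrite (@le_trans _ _ 1)// ?lerDr ?rho_ge0//.
  by apply: ge_inf; [case: (set_dist_has_inf C x) | left].
apply: le_trans (rho_triangle x y z).
by apply: ge_inf; [case: (set_dist_has_inf C x) | right; exists z].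
Qed.

Lemma set_dist_eq0 C x : C x -> set_dist C x = 0.
Proof.
move=> Cx; apply/eqP; rewrite eq_le set_dist_ge0 andbT.
apply: ge_inf; first by case: (set_dist_has_inf C x).
by right; exists x => //; rewrite rho_xx.
Qed.

Lemma set_dist_gt0 C x : closed C -> ~ C x -> 0 < set_dist C x.
Proof.
move=> Ccl Cx; have : nbhs x (~` C).
  by apply: open_nbhs_nbhs; split => //; apply: closed_openC.
move=> /nbhs_rhoP[e e0 eC]; apply: (@lt_le_trans _ _ (Num.min 1 e)).
  by rewrite lt_min ltr01.
apply: lb_le_inf; first by exists 1; left.
move=> _ [->|[z Cz <-]]; first by rewrite ge_min lexx.
by rewrite ge_min; apply/orP; right; rewrite leNgt; apply/negP => /eC.
Qed.

Context (X_compact : compact [set: X]).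

Lemma uniform_continuity (h : X -> R) (e : R) : continuous h -> 0 < e ->
  exists2 del, 0 < del & forall x y, rho x y < del -> `|h x - h y| <= e.
Proof.
move=> hc e0; pose Q (A : set X) := exists2 del, 0 < del &
  forall x y, A x -> rho x y < del -> `|h x - h y| <= e.
suff [del del0 H] : Q setT by exists del => // x y; apply: H.
apply: compact_induction X_compact.
- by exists 1.
- by move=> A B AB [del del0 H]; exists del => // x y /AB; apply: H.
- move=> A B [d1 d10 H1] [d2 d20 H2]; exists (Num.min d1 d2).
    by rewrite lt_min d10.
  by move=> x y [Ax|Bx]; rewrite lt_min => /andP[? ?]; [apply: H1|apply: H2].
- move=> x0 _; have e20 : 0 < e / 2 by rewrite divr_gt0.
  have /cvgrPdist_lt /(_ _ e20) /nbhs_rhoP[r r0 Hr] := hc x0.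
  exists [set y | rho x0 y < r / 2]; first by apply: nbhs_rho_ball; rewrite divr_gt0.
  exists (r / 2); first by rewrite divr_gt0.
  move=> x y [/= xr _] xy.
  have /= := Hr x; have /= := Hr y; have := rho_triangle x0 x y.
  move=> tr /(_ ltac:(lra)) + /(_ ltac:(lra)).
  by rewrite !ltr_norml ler_norml => /andP[? ?] /andP[? ?]; apply/andP; split; lra.
Qed.

Lemma uniform_continuity_fin (I : finType) (h : I -> X -> R) (e : R) :
  (forall i, continuous (h i)) -> 0 < e ->
  exists2 del, 0 < del & forall i x y, rho x y < del -> `|h i x - h i y| <= e.
Proof.
move=> hc e0.
have del i := cid2 (uniform_continuity (hc i) e0).
exists (\big[Num.min/1]_i projT1 (del i)).
  by apply: lt_bigmin => // i _; case: (del i).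
move=> i x y xy; have : rho x y < projT1 (del i).
  by apply: lt_le_trans xy _; apply: bigmin_le.
by case: (del i) => /= a a0; apply.
Qed.

End metric.

(** * Partitions of unity from covering dimension *)

Lemma continuous_sum (R : realType) (T : topologicalType) (I : Type)
    (r : seq I) (P : pred I) (F : I -> T -> R) :
  (forall i, P i -> continuous (F i)) ->
  continuous (fun x => \sum_(i <- r | P i) F i x).
Proof. by apply: continuous_big; exact: add_continuous. Qed.

Section partitions.
Context (R : realType) (X : topologicalType) (rho : X -> X -> R).
Context (rho_metric : metric_inducing rho).
Context (X_compact : compact [set: X]).

(* The covers witnessing [dim S <= m], traded for partitions of unity with
   fine supports: the latter restrict to subsets of [S] and extend to [X]. *)
Definition fine_partitions (S : set X) (m : nat) : Prop :=
  forall del : R, 0 < del -> exists (n : nat) (phi : nat -> X -> R),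
    [/\ forall i, continuous (phi i),
        forall i x, 0 <= phi i x,
        forall x, S x -> \sum_(i < n) phi i x = 1,
        forall x, S x -> (\sum_(i < n) (phi i x != 0%R) <= m.+1)%N &
        forall i x y, (i < n)%N -> S x -> S y -> phi i x != 0 ->
          phi i y != 0 -> rho x y < del].

Lemma finite_ball_cover (del : R) : 0 < del ->
  exists s : seq X, forall x, exists2 c, c \in s & rho c x < del.
Proof.
move=> del0; pose Q (A : set X) :=
  exists s : seq X, forall x, A x -> exists2 c, c \in s & rho c x < del.
suff [s H] : Q setT by exists s => x; apply: H.
apply: compact_induction X_compact.
- by exists [::].
- by move=> A B AB [s Hs]; exists s => x /AB; apply: Hs.
- move=> A B [s Hs] [t Ht]; exists (s ++ t) => x [/Hs|/Ht] [c cs h].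
    by exists c; rewrite // mem_cat cs.
  by exists c; rewrite // mem_cat cs orbT.
- move=> x _; exists [set y | rho x y < del]; first exact: nbhs_rho_ball.
  by exists [:: x] => y [/= xy _]; exists x; rewrite ?mem_seq1.
Qed.

(** The cover by balls of radius [del / 2] is refined to one of order at most [m], and the distances
    to the complements of its members are normalized. Closedness of [iota] makes these distances
    positive on the members. *)
Lemma top_dim_fine_partitions (Y : topologicalType) (iota : Y -> X) (m : nat) :
  continuous iota -> injective iota ->
  (forall C, closed C -> closed (iota @` C)) ->
  (top_dim R Y < (m.+1%:R : R)%:E)%E -> fine_partitions (range iota) m.
Proof.
move=> ioc ioi iocl; rewrite /top_dim.
case: asboolP => [Y0 _ del del0|/eqP/set0P[y0 _] dimY del del0].
  (* For empty [Y], where [top_dim] is 0 by convention, the empty partition serves. *)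
  exists 0%N, (fun _ _ => 0); split.
  - by move=> i; apply: cst_continuous.
  - by [].
  - by move=> x [y _ _]; exfalso; have : [set: Y] y by []; rewrite Y0.
  - by move=> x [y _ _]; exfalso; have : [set: Y] y by []; rewrite Y0.
  - by [].
have [s Hs] := @finite_ball_cover (del / 2) ltac:(lra).
pose a : set (set Y) :=
  (fun c => iota @^-1` [set x | rho c x < del / 2]) @` [set` s].
have aC : finite_open_cover a.
  split.
  - exact/finite_image/finite_seq.
  - move=> _ [c _ <-]; apply: open_comp => //.
    have [_ _ _ H] := rho_metric; apply/H => x /= cx.
    exists (del / 2 - rho c x); first by rewrite subr_gt0.
    move=> z /= xz; rewrite (le_lt_trans (rho_triangle rho_metric c x z))//.
    by rewrite -ltrBrDl.
  - apply/seteqP; split=> // y _; have [c cs cy] := Hs (iota y).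
    by exists (iota @^-1` [set x | rho c x < del / 2]) => //; exists c.
have : (cover_dim R a < (m.+1%:R : R)%:E)%E.
  by apply: le_lt_trans dimY; apply: ereal_sup_ubound; exists a.
move=> /ereal_inf_lt[_ [b [[bfin bop bcov] bref] <-]] bord.
pose l : seq (set Y) := finmap.enum_fset (fset_set b).
have lb U : U \in l <-> b U by rewrite in_fset_set // inE.
pose V i := nth set0 l i.
have Vb i : (i < size l)%N -> b (V i) by move=> il; apply/lb/mem_nth.
pose psi i := set_dist rho (iota @` (~` V i)).
have psi_cont i : continuous (psi i) by exact: set_dist_continuous.
have psi_gt0 i y : (i < size l)%N -> V i y -> 0 < psi i (iota y).
  move=> il Vy; apply: set_dist_gt0 => //.
    by apply/iocl/open_closedC/bop/Vb.
  by move=> [z /[swap] /ioi ->].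
have psi_eq0 i y : ~ V i y -> psi i (iota y) = 0.
  by move=> Vy; apply: set_dist_eq0 => //; exists y.
(* The last term vanishes on [range iota], where the partition must sum to 1, and is positive off
   it, so that the quotients are continuous on all of [X]. *)
pose den x := \sum_(i < size l) psi i x + set_dist rho (range iota) x.
have den_gt0 x : 0 < den x.
  have sum_ge0 : 0 <= \sum_(i < size l) psi i x.
    by apply: sumr_ge0 => i _; apply: set_dist_ge0.
  have d0 := set_dist_ge0 rho_metric (range iota) x.
  have [[y _ yx]|nx] := pselect (range iota x); last first.
    by apply: ltr_wpDl => //; apply: set_dist_gt0 => //; apply/iocl/closedT.
  apply: ltr_pwDl => //.
  have : (\bigcup_(U in b) U) y by rewrite bcov.
  move=> [U /lb Ul Uy]; have il : (index U l < size l)%N by rewrite index_mem.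
  rewrite (bigD1 (Ordinal il)) //= ltr_pwDl ?sumr_ge0 //.
    by rewrite -yx psi_gt0 // /V nth_index.
  by move=> i _; apply: set_dist_ge0.
have phi_neq0 i y : psi i (iota y) / den (iota y) != 0 -> V i y.
  by move=> h; apply: contrapT => /psi_eq0 h'; rewrite h' mul0r eqxx in h.
exists (size l), (fun i x => psi i x / den x); split.
- move=> i x; apply: cvgM; first exact: psi_cont.
  apply: cvgV; first by rewrite gt_eqF.
  apply: cvgD; last exact: set_dist_continuous.
  by apply: continuous_sum => j _; apply: psi_cont.
- by move=> i x; rewrite divr_ge0 ?set_dist_ge0 // ltW.
- move=> _ [y _ <-]; rewrite -mulr_suml.
  have d0 : set_dist rho (range iota) (iota y) = 0.
    by apply: set_dist_eq0 => //; exists y.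
  move: (den_gt0 (iota y)); rewrite /den d0 addr0 => h.
  by rewrite divff // gt_eqF.
(* [cover_ord] subtracts 1, so order below [m.+1] means that fewer than [m.+2] members meet at a
   point. *)
- move=> _ [y _ <-]; rewrite -ltnS -(ltr_nat R).
  have : ((\sum_(U \in b) (\1_U y : R))%:E - 1 < (m.+1%:R : R)%:E)%E.
    apply: le_lt_trans bord; rewrite /cover_ord leeD2r //.
    by apply: ereal_sup_ubound; exists y.
  rewrite -EFinB lte_fin ltrBlDr natr1; apply: le_lt_trans.
  rewrite fsbig_finite // (big_nth set0) big_mkord natr_sum.
  apply: ler_sum => i _; rewrite indicE.
  have [/phi_neq0 h|//] := boolP (_ != _).
  by rewrite mem_set.
- move=> i _ _ il [y _ <-] [z _ <-] /phi_neq0 Vy /phi_neq0 Vz.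
  have [_ [c _ <-] Vc] := bref _ (Vb i il).
  have /= := Vc _ Vy; have /= := Vc _ Vz.
  have := rho_triangle rho_metric (iota y) c (iota z).
  rewrite (rho_sym rho_metric _ c); lra.
Qed.

End partitions.

(** * Polyhedral perturbations *)

Section perturbation.
Context (R : realType) (X : topologicalType) (rho : X -> X -> R).
Context (rho_metric : metric_inducing rho).
Context (X_compact : compact [set: X]).

Lemma homog_combination (D n : nat) (a : nat -> R) (v : nat -> 'rV[R]_D) :
  \sum_(i < n) a i = 1 ->
  homog (\sum_(i < n) a i *: v i) = \sum_(i < n) a i *: homog (v i).
Proof.
move=> a1; apply/matrixP => i j; rewrite (ord1 i) [RHS]summxE.
case: (split_ordP j) => k ->.
  rewrite row_mxEl mxE (ord1 k) eqxx -a1; apply: eq_bigr => l _.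
  by rewrite mxE row_mxEl mxE eqxx mulr1.
rewrite row_mxEr summxE; apply: eq_bigr => l _.
by rewrite mxE [RHS]mxE row_mxEr.
Qed.

(** The map to the nerve: each vertex is a value of [G] on the support of its function, and a point
    averages only vertices whose supports contain it. The bound allows for moving the vertices by
    [eps], hence into general position. *)
Lemma nerve_approximation (S : set X) (m D : nat) (G : X -> 'rV[R]_D) (eps : R) :
  fine_partitions rho S m -> (forall c, continuous (fun x => G x 0 c)) ->
  0 < eps ->
  exists (n : nat) (phi : nat -> X -> R) (v0 : nat -> 'rV[R]_D),
    [/\ forall i, continuous (phi i),
        forall x, S x -> \sum_(i < n) phi i x = 1,
        forall x, S x -> (\sum_(i < n) (phi i x != 0%R) <= m.+1)%N &
        forall v : nat -> 'rV[R]_D,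
          (forall i c, (i < n)%N -> `|v i 0 c - v0 i 0 c| <= eps) ->
          forall x c, S x ->
            `|(\sum_(i < n) phi i x *: v i) 0 c - G x 0 c| <= 2 * eps].
Proof.
move=> fineS Gc e0.
have [del del0 Hdel] :=
  uniform_continuity_fin rho_metric X_compact Gc e0.
have [n [phi [phic phi0 phi1 phim phid]]] := fineS _ del0.
have /choice[v0 Hv0] (i : nat) : exists v : 'rV[R]_D, (i < n)%N ->
    forall x c, S x -> phi i x != 0 -> `|v 0 c - G x 0 c| <= eps.
  have [[a [Sa pa]]|na] := pselect (exists a, S a /\ phi i a != 0).
    exists (G a) => il x c Sx px; apply: Hdel.
    exact: (phid i).
  (* The support misses [S], so any vertex will do. *)
  by exists 0 => il x c Sx px; exfalso; apply: na; exists x.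
exists n, phi, v0; split => // v vv0 x c Sx.
have -> : (\sum_(i < n) phi i x *: v i) 0 c - G x 0 c =
    \sum_(i < n) phi i x * (v i 0 c - G x 0 c).
  under [RHS]eq_bigr do rewrite mulrBr.
  rewrite sumrB -mulr_suml phi1 // mul1r summxE.
  by congr (_ - _); apply: eq_bigr => i _; rewrite mxE.
apply: le_trans (ler_norm_sum _ _ _) _.
rewrite -[leRHS]mul1r; set e2 := 2 * eps; rewrite -(phi1 x Sx) mulr_suml.
apply: ler_sum => i _.
rewrite normrM ger0_norm //.
have [->|px] := eqVneq (phi i x) 0; first by rewrite !mul0r.
apply: ler_wpM2l => //.
have h1 := Hv0 i (ltn_ord i) x c Sx px.
have h2 := vv0 i c (ltn_ord i).
have -> : v i 0 c - G x 0 c = (v i 0 c - v0 i 0 c) + (v0 i 0 c - G x 0 c).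
  by rewrite addrA subrK.
apply: le_trans (ler_normD _ _) _. by rewrite /e2 mulr_natl mulr2n lerD.
Qed.

Lemma nerve_map_continuous (D n : nat) (phi : nat -> X -> R)
    (v : nat -> 'rV[R]_D) (c : 'I_D) : (forall i, continuous (phi i)) ->
  continuous (fun x => (\sum_(i < n) phi i x *: v i) 0 c).
Proof.
move=> phic.
rewrite (_ : (fun x => _) = fun x => \sum_(i < n) phi i x * v i 0 c).
  apply: continuous_sum => i _ x; apply: cvgMr_tmp; exact: phic.
by apply/funext => x; rewrite summxE; apply: eq_bigr => i _; rewrite mxE.
Qed.

(** The matrices [Ms] span the faces of the nerve with at most [m.+1] vertices. *)
Lemma polyhedral_approximation (S : set X) (m D : nat) (G : X -> 'rV[R]_D)
    (eps : R) :
  fine_partitions rho S m -> (forall c, continuous (fun x => G x 0 c)) ->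
  0 < eps ->
  exists (G' : X -> 'rV[R]_D) (Ms : seq 'M[R]_(1 + D)),
    [/\ forall c, continuous (fun x => G' x 0 c),
        forall x c, S x -> `|G' x 0 c - G x 0 c| <= eps,
        forall M, M \in Ms -> (\rank M <= m.+1)%N &
        forall x, S x -> exists2 M, M \in Ms & (homog (G' x) <= M)%MS].
Proof.
move=> fineS Gc e0; have e20 : 0 < eps / 2 by rewrite divr_gt0.
have [n [phi [v0 [phic phi1 phim Hv]]]] := nerve_approximation fineS Gc e20.
pose Sp (J : {set 'I_n}) : 'M[R]_(1 + D) :=
  (\sum_(i in J) <<homog (v0 i)>>)%MS.
pose Ms := [seq Sp J | J <- enum [pred J : {set 'I_n} | (#|J| <= m.+1)%N]].
exists (fun x => \sum_(i < n) phi i x *: v0 i), Ms; split.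
- by move=> c; apply: nerve_map_continuous.
- move=> x c Sx; have := Hv v0 _ x c Sx; rewrite [2 * _]mulrC divfK //; apply.
  by move=> i c' _; rewrite subrr normr0 ltW.
- move=> M /mapP[J]; rewrite mem_enum inE => Jm ->.
  apply: leq_trans (mxrank_sum_leq _ _) (leq_trans _ Jm).
  rewrite -sum1_card; apply: leq_sum => i _.
  by rewrite genmxE rank_leq_row.
- move=> x Sx; pose J : {set _} := [set i : 'I_n | phi i x != 0%R]%SET.
  exists (Sp J).
    apply: map_f; rewrite mem_enum inE; apply: leq_trans (phim x Sx).
    rewrite -sum1_card big_mkcond /=.
    by apply: leq_sum => i _; rewrite inE; case: (_ != _).
  rewrite (@homog_combination D n (phi^~ x) v0 (phi1 x Sx)); apply: summx_sub => i _.
  have [->|px] := eqVneq (phi i x) 0; first by rewrite scale0r sub0mx.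
  by apply: scalemx_sub; apply: (sumsmx_sup i); rewrite ?inE // genmxE.
Qed.

(** With vertices in general position, a point of a face that lies in some [M] would have all its
    weights zero, although they sum to 1. The condition [r + m <= D] says that affine dimensions
    [r - 1] and [m] add up to less than [D]. *)
Lemma avoiding_approximation (S : set X) (m D r : nat) (G : X -> 'rV[R]_D)
    (eps : R) (Ms : seq 'M[R]_(1 + D)) :
  fine_partitions rho S m -> (forall c, continuous (fun x => G x 0 c)) ->
  0 < eps -> (forall M, M \in Ms -> (\rank M <= r)%N) -> (r + m <= D)%N ->
  exists G' : X -> 'rV[R]_D,
    [/\ forall c, continuous (fun x => G' x 0 c),
        forall x c, S x -> `|G' x 0 c - G x 0 c| <= eps &
        forall x M, S x -> M \in Ms -> ~~ (homog (G' x) <= M)%MS].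
Proof.
move=> fineS Gc e0 rM rmD; have e20 : 0 < eps / 2 by rewrite divr_gt0.
have [n [phi [v0 [phic phi1 phim Hv]]]] := nerve_approximation fineS Gc e20.
have [v vv0 vP] := @general_position _ _ _ _ n _ v0 _ e20 rM rmD.
exists (fun x => \sum_(i < n) phi i x *: v i); split.
- by move=> c; apply: nerve_map_continuous.
- by move=> x c Sx; have := Hv v vv0 x c Sx; rewrite [2 * _]mulrC divfK.
- move=> x M Sx MMs; apply/negP.
  rewrite (@homog_combination D n (phi^~ x) v (phi1 x Sx)).
  move=> /(vP (fun i => phi i x) M MMs (phim x Sx)) phi0.
  have /eqP := phi1 x Sx; rewrite big1 ?(eq_sym 0) ?oner_eq0 // => i _.
  exact: phi0.
Qed.

End perturbation.

(** * Generic separation of pairs *)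

Lemma continuous_comp_fun (X Y Z : topologicalType) (f : X -> Y) (g : Y -> Z) :
  continuous f -> continuous g -> continuous (g \o f).
Proof. by move=> fc gc x; apply: continuous_comp; [exact: fc | exact: gc]. Qed.

Lemma iter_continuous (X : topologicalType) (T : X -> X) (i : nat) :
  continuous T -> continuous (iter i T).
Proof.
move=> Tc; elim: i => [|i IH]; first by move=> x; exact: cvg_id.
exact: continuous_comp_fun IH Tc.
Qed.

Lemma closed_preimage_le (R : realType) (Z : topologicalType) (h : Z -> R) (c : R) :
  continuous h -> closed [set z | h z <= c].
Proof. by move=> /continuous_closedP /(_ _ (@closed_le R c)). Qed.

Lemma closed_preimage_ge (R : realType) (Z : topologicalType) (h : Z -> R) (c : R) :
  continuous h -> closed [set z | c <= h z].
Proof. by move=> /continuous_closedP /(_ _ (@closed_ge R c)). Qed.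

Lemma closed_forall (Z : topologicalType) (I : Type) (A : I -> set Z) :
  (forall i, closed (A i)) -> closed [set z | forall i, A i z].
Proof.
move=> Acl; rewrite (_ : mkset _ = \bigcap_(i in setT) A i).
  by apply: closed_bigI => i _.
by apply/seteqP; split=> z h i; [move=> _|]; apply: h.
Qed.

Section separation.
Context (R : realType) (X : topologicalType) (rho : X -> X -> R).
Context (rho_metric : metric_inducing rho).
Context (X_compact : compact [set: X]).
Context (T : X -> X) (d : nat).
Context (T_continuous : continuous T).

Lemma rho_comp_continuous (Z : topologicalType) (u v : Z -> X) :
  continuous u -> continuous v -> continuous (fun z => rho (u z) (v z)).
Proof.
move=> uc vc z.
apply: (@continuous_comp _ _ _ (fun z => (u z, v z)) (fun w => rho w.1 w.2)).
  by apply: cvg_pair; [exact: uc | exact: vc].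
exact: rho_continuous.
Qed.

(** The bump [chi i] is 1 within [r] of [c i] and 0 beyond [2 * r], hence 0 within [r] of every
    other centre. Clamping bounds each correction by [eps] even where [h i] is far from [f]; the
    factor [#|I|] allows for overlapping bumps. *)
Lemma glue_functions (I : finType) (c : I -> X) (r eps : R) (f : 'I_d -> X -> R)
    (h : I -> 'I_d -> X -> R) :
  0 < r -> 0 < eps ->
  (forall i j, i != j -> 3 * r <= rho (c i) (c j)) ->
  (forall k, continuous (f k)) -> (forall i k, continuous (h i k)) ->
  exists g : 'I_d -> X -> R,
    [/\ forall k, continuous (g k),
        forall k z, `|g k z - f k z| <= #|I|%:R * eps &
        forall i k z, rho z (c i) <= r -> `|h i k z - f k z| <= eps ->
          g k z = h i k z].
Proof.
move=> r0 e0 sep fc hc.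
pose chi i z := Num.max 0 (Num.min 1 (2 - rho z (c i) / r)).
pose clamp (t : R) := Num.max (- eps) (Num.min eps t).
have chi0 i z : 0 <= chi i z by rewrite le_max lexx.
have chi1 i z : chi i z <= 1 by rewrite ge_max ler01 ge_min lexx.
have chi_near i z : rho z (c i) <= r -> chi i z = 1.
  move=> zi; have zr : rho z (c i) / r <= 1 by rewrite ler_pdivrMr ?mul1r.
  by rewrite /chi min_l ?max_r ?ler01 //; lra.
have chi_far i j z : i != j -> rho z (c i) <= r -> chi j z = 0.
  move=> ij zi; have zr : 2 <= rho z (c j) / r.
    rewrite ler_pdivlMr //; have := sep i j ij.
    have := rho_triangle rho_metric (c i) z (c j).
    rewrite (rho_sym rho_metric (c i) z); lra.
  by rewrite /chi min_r ?max_l //; lra.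
have clampE t : `|t| <= eps -> clamp t = t.
  by rewrite ler_norml => /andP[t1 t2]; rewrite /clamp min_r ?max_r.
have clamp_le t : `|clamp t| <= eps.
  rewrite ler_norml le_max lexx /= ge_max ge_min lexx andbT; lra.
have clamp_cont : continuous clamp.
  apply: max_fun_continuous; first exact: cst_continuous.
  by apply: min_fun_continuous => x; [exact: cst_continuous | exact: cvg_id].
have chi_cont i : continuous (chi i).
  apply: max_fun_continuous; first exact: cst_continuous.
  apply: min_fun_continuous => x; first exact: cst_continuous.
  apply: cvgB; first exact: cvg_cst.
  apply: cvgMr_tmp; apply: rho_comp_continuous => y; first exact: cvg_id.
  exact: cvg_cst.
exists (fun k z => f k z + \sum_i chi i z * clamp (h i k z - f k z)); split.
- move=> k z; apply: cvgD; first exact: fc.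
  apply: continuous_sum => i _ x; apply: cvgM; first exact: chi_cont.
  apply: (@continuous_comp _ _ _ (fun x => h i k x - f k x) clamp).
    by apply: cvgB; [exact: hc | exact: fc].
  exact: clamp_cont.
- move=> k z; rewrite addrC addKr; apply: le_trans (ler_norm_sum _ _ _) _.
  rewrite mulr_natl -sumr_const; apply: ler_sum => i _.
  by rewrite normrM ger0_norm // -[leRHS]mul1r ler_pM.
- move=> i k z zi hf; rewrite (bigD1 i) //= big1 ?addr0.
    by rewrite chi_near // mul1r clampE // addrC subrK.
  by move=> j ji; rewrite (@chi_far i) ?mul0r // eq_sym.
Qed.

Definition separates (f : 'I_d -> X -> R) (K : set (X * X)) : Prop :=
  forall a b, K (a, b) -> exists i k, f k (iter i T a) <> f k (iter i T b).

(** In the sup norm: the interior of the set of functions separating [K] is dense. This is the form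
    that the Baire argument consumes. *)
Definition generically_separated (K : set (X * X)) : Prop :=
  forall (f : 'I_d -> X -> R) (eps : R), (forall k, continuous (f k)) ->
    0 < eps -> exists g : 'I_d -> X -> R,
      [/\ forall k, continuous (g k),
          forall k z, `|g k z - f k z| <= eps &
          exists2 eta, 0 < eta & forall h : 'I_d -> X -> R,
            (forall k z, `|h k z - g k z| <= eta) -> separates h K].

(** Near each pair a single coordinate keeps a positive gap, and compactness leaves finitely many
    gaps. *)
Lemma separates_robust (K : set (X * X)) (g : 'I_d -> X -> R) :
  compact K -> (forall k, continuous (g k)) -> separates g K ->
  exists2 eta, 0 < eta & forall h : 'I_d -> X -> R,
    (forall k z, `|h k z - g k z| <= eta) -> separates h K.
Proof.
move=> Kco gc gK; pose Q (L : set (X * X)) :=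
  exists2 eta, 0 < eta & forall h : 'I_d -> X -> R,
    (forall k z, `|h k z - g k z| <= eta) -> separates h L.
rewrite -/(Q K).
apply: (@compact_induction _ K Q _ _ _ _ Kco).
- by exists 1 => // h _ a b.
- by move=> A B AB [eta e0 H]; exists eta => // h /H hB a b /AB; apply: hB.
- move=> A B [e1 e10 H1] [e2 e20 H2]; exists (Num.min e1 e2).
    by rewrite lt_min e10.
  move=> h hg a b [Aab|Bab].
    by apply: H1 Aab => k z; apply: le_trans (hg k z) _; rewrite ge_min lexx.
  by apply: H2 Bab => k z; apply: le_trans (hg k z) _; rewrite ge_min lexx orbT.
- move=> [a b] Kab; have [i [k gab]] := gK a b Kab.
  pose D (z : X * X) := `|g k (iter i T z.1) - g k (iter i T z.2)|.
  have D0 : 0 < D (a, b) by rewrite normr_gt0 subr_eq0; apply/eqP.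
  have Dc : continuous D.
    move=> z; apply: cvg_norm; apply: cvgB.
      apply: (@continuous_comp _ _ _ (fun z : X * X => iter i T z.1) (g k));
        last exact: gc.
      apply: (@continuous_comp _ _ _ fst (iter i T)); first exact: cvg_fst.
      exact: iter_continuous.
    apply: (@continuous_comp _ _ _ (fun z : X * X => iter i T z.2) (g k));
      last exact: gc.
    apply: (@continuous_comp _ _ _ snd (iter i T)); first exact: cvg_snd.
    exact: iter_continuous.
  exists [set z | D (a, b) / 2 < D z].
    apply: (cvgr_gt (D (a, b)) (Dc (a, b))).
    by rewrite ltr_pdivrMr // ltr_pMr // ltr1n.
  (* Two errors of a fifth of the gap stay below the half that survives nearby. *)
  exists (D (a, b) / 5); first by rewrite divr_gt0.
  move=> h hg a' b' [/= Dab' _]; exists i, k => hab.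
  have := hg k (iter i T a'); have := hg k (iter i T b'); rewrite hab.
  move: Dab'; rewrite /D /= => + h1 h2.
  have : `|g k (iter i T a') - g k (iter i T b')| <= D (a, b) / 5 + D (a, b) / 5.
    rewrite -(subrKA (h k (iter i T b'))) addrC; apply: le_trans (ler_normD _ _) _.
    by rewrite lerD // distrC.
  rewrite -/(D (a, b)); move: D0; lra.
Qed.

Lemma generically_separated_subset (K L : set (X * X)) :
  K `<=` L -> generically_separated L -> generically_separated K.
Proof.
move=> KL HL f eps fc e0; have [g [gc gf [eta eta0 H]]] := HL f eps fc e0.
exists g; split => //; exists eta => // h /H hL a b /KL; exact: hL.
Qed.

Lemma generically_separated0 : generically_separated set0.
Proof.
move=> f eps fc e0; exists f; split => //; last by exists 1 => // h _ a b.
by move=> k z; rewrite subrr normr0 ltW.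
Qed.

(** The second perturbation uses at most half of the margin [eta1] won by the first, and the other
    half is left for [h]. *)
Lemma generically_separatedU (K L : set (X * X)) :
  generically_separated K -> generically_separated L ->
  generically_separated (K `|` L).
Proof.
move=> HK HL f eps fc e0; have e20 : 0 < eps / 2 by rewrite divr_gt0.
have [g1 [g1c g1f [eta1 eta10 H1]]] := HK f _ fc e20.
have m0 : 0 < Num.min (eps / 2) (eta1 / 2) by rewrite lt_min e20 divr_gt0.
have [g2 [g2c g2g [eta2 eta20 H2]]] := HL g1 _ g1c m0.
have gg k z : `|g2 k z - g1 k z| <= eps / 2 /\ `|g2 k z - g1 k z| <= eta1 / 2.
  by have := g2g k z; rewrite le_min => /andP[].
exists g2; split => //.
  move=> k z; rewrite -(subrKA (g1 k z)); apply: le_trans (ler_normD _ _) _.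
  by rewrite [leRHS]splitr lerD //; case: (gg k z).
exists (Num.min eta2 (eta1 / 2)); first by rewrite lt_min eta20 divr_gt0.
move=> h hg2; have hg k z : `|h k z - g2 k z| <= eta2 /\ `|h k z - g2 k z| <= eta1 / 2.
  by have := hg2 k z; rewrite le_min => /andP[].
move=> a b [Kab|Lab]; last by apply: H2 Lab => k z; case: (hg k z).
apply: H1 Kab => k z; rewrite -(subrKA (g2 k z)).
apply: le_trans (ler_normD _ _) _.
by rewrite [leRHS]splitr lerD //; [case: (hg k z) | case: (gg k z)].
Qed.

Lemma compact_setT_prod : compact [set: X * X].
Proof.
rewrite (_ : setT = setT `*` setT); first exact: compact_setX.
by apply/seteqP; split.
Qed.

(** Closed neighbourhoods of this form are compact, so separation on them is robust, and finitely
    many cover [K]. The centres [c i z0] stay fixed while [z] varies, as gluing requires. *)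
Lemma generically_separated_local (I : finType) (c : I -> X * X -> X)
    (K : set (X * X)) (r : R) :
  0 < r -> closed K -> (forall i, continuous (c i)) ->
  (forall z0 (f : 'I_d -> X -> R) (eps : R), K z0 ->
    (forall k, continuous (f k)) -> 0 < eps ->
    exists g : 'I_d -> X -> R,
      [/\ forall k, continuous (g k),
          forall k z, `|g k z - f k z| <= eps &
          separates g (K `&` [set z | forall i, rho (c i z) (c i z0) <= r])]) ->
  generically_separated K.
Proof.
move=> r0 Kcl cc Kloc; have KT (L : set (X * X)) : closed L -> compact L.
  by move=> Lcl; exact: subclosed_compact Lcl compact_setT_prod _.
apply: (@compact_induction _ K generically_separated _ _ _ _ (KT _ Kcl)).
- exact: generically_separated0.
- by move=> A B; apply: generically_separated_subset.
- exact: generically_separatedU.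
- move=> z0 Kz0; pose B := [set z | forall i, rho (c i z) (c i z0) <= r].
  exists B.
    have : \forall z \near z0, forall i, rho (c i z) (c i z0) <= r.
      apply: (@filter_forall _ I (fun i z => rho (c i z) (c i z0) <= r)
        (nbhs z0) (nbhs_filter z0)) => i.
      have ci : continuous (fun z => rho (c i z) (c i z0)).
        by apply: rho_comp_continuous => // z; exact: cvg_cst.
      by apply: (cvgr_le _ (ci z0)); rewrite rho_xx.
    exact.
  have Bcl : closed B.
    apply: closed_forall => i; apply: closed_preimage_le.
    by apply: rho_comp_continuous => // z; exact: cvg_cst.
  rewrite setIC => f eps fc e0; have [g [gc gf gs]] := Kloc z0 f eps Kz0 fc e0.
  exists g; split=> //; apply: separates_robust => //.
  by apply: KT; exact: closedI.
Qed.

End separation.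

(** * Orbit segments *)

Section folding.
Context (R : fieldType) (d : nat).

(** The linear map on flattened matrices that copies row [phi j] to row [j]. With [phi] a remainder
    it unrolls a short orbit segment periodically. *)
Definition refold (P Q : nat) (phi : 'I_Q -> 'I_P) : 'M[R]_(P * d, Q * d) :=
  lin_mx (mulmx (rowsub phi 1%:M)).

Lemma mul_refold (P Q : nat) (phi : 'I_Q -> 'I_P) (V : 'M[R]_(P, d)) :
  mxvec V *m refold phi = mxvec (rowsub phi V).
Proof. by rewrite mul_vec_lin /= -rowsubE. Qed.

Definition homog_mx (m n : nat) (L : 'M[R]_(m, n)) : 'M[R]_(1 + m, 1 + n) :=
  block_mx 1%:M 0 0 L.

Lemma homog_mul (m n : nat) (w : 'rV[R]_m) (L : 'M[R]_(m, n)) :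
  homog (w *m L) = homog w *m homog_mx L.
Proof. by rewrite /homog mul_row_block !mulmx0 addr0 add0r mulmx1. Qed.

End folding.

Lemma closed_imply (Z : topologicalType) (P : Prop) (A : set Z) :
  closed A -> closed [set z | P -> A z].
Proof.
move=> Acl; have [p|np] := pselect P.
  by rewrite (_ : [set z | P -> A z] = A) //; apply/seteqP; split=> z //=; apply.
rewrite (_ : [set z | P -> A z] = setT); first exact: closedT.
by apply/seteqP; split=> z // _ /np.
Qed.

Section orbits.
Context (R : realType) (X : topologicalType) (rho : X -> X -> R).
Context (rho_metric : metric_inducing rho).
Context (X_compact : compact [set: X]).
Context (T Tinv : X -> X) (d : nat).
Context (T_continuous : continuous T).
Context (Tinv_continuous : continuous Tinv).
Context (TK : cancel T Tinv).

Lemma iterK i x : iter i Tinv (iter i T x) = x.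
Proof. by elim: i x => // i IH x; rewrite iterSr /= TK IH. Qed.

Definition orbit_vector (P : nat) (f : 'I_d -> X -> R) (x : X) : 'rV[R]_(P * d) :=
  mxvec (\matrix_(i < P, k < d) f k (iter i T x)).

Lemma orbit_vectorE P f x (i : 'I_P) (k : 'I_d) :
  orbit_vector P f x 0 (mxvec_index i k) = f k (iter i T x).
Proof. by rewrite mxvecE mxE. Qed.

Lemma orbit_vector_continuous P f c : (forall k, continuous (f k)) ->
  continuous (fun x => orbit_vector P f x 0 c).
Proof.
move=> fc; case/mxvec_indexP: c => i k.
rewrite (_ : (fun x => _) = f k \o iter i T).
  by apply: continuous_comp_fun; [exact: iter_continuous | exact: fc].
by apply/funext => x; rewrite orbit_vectorE.
Qed.

Lemma pullback_continuous P (G : X -> 'rV[R]_(P * d)) (i : 'I_P) (k : 'I_d) :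
  (forall c, continuous (fun x => G x 0 c)) ->
  continuous (fun z => G (iter i Tinv z) 0 (mxvec_index i k)).
Proof.
move=> Gc; apply: (@continuous_comp_fun _ _ _ (iter i Tinv)
  (fun x => G x 0 (mxvec_index i k))); last exact: Gc.
exact: iter_continuous.
Qed.

Definition two_orbits (P Q : nat) (i : 'I_P + 'I_Q) (z : X * X) : X :=
  match i with inl i => iter i T z.1 | inr j => iter j T z.2 end.

Lemma iter_fst_continuous i : continuous (fun z : X * X => iter i T z.1).
Proof.
apply: (@continuous_comp_fun _ _ _ fst (iter i T)); last exact: iter_continuous.
by move=> z; exact: cvg_fst.
Qed.

Lemma iter_snd_continuous i : continuous (fun z : X * X => iter i T z.2).
Proof.
apply: (@continuous_comp_fun _ _ _ snd (iter i T)); last exact: iter_continuous.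
by move=> z; exact: cvg_snd.
Qed.

Lemma two_orbits_continuous P Q (i : 'I_P + 'I_Q) : continuous (two_orbits i).
Proof.
by case: i => i; [exact: iter_fst_continuous | exact: iter_snd_continuous].
Qed.

Lemma closed_separated (I : eqType) (c : I -> X * X -> X) (del : R) :
  (forall i, continuous (c i)) ->
  closed [set z | forall i j, i != j -> del <= rho (c i z) (c j z)].
Proof.
move=> cc; apply: closed_forall => i; apply: closed_forall => j.
apply: (@closed_imply _ (i != j) [set z | del <= rho (c i z) (c j z)]).
by apply: closed_preimage_ge; apply: rho_comp_continuous.
Qed.

(* For points with disjoint orbit segments the segments of [a] and [b] can be
   perturbed independently; the [b]-segment then misses the dimension [mA]
   polyhedron swept out by the [a]-segments, since [mA + mB < Q d]. *)
Lemma generically_separated_two_orbits (P Q : nat) (SA SB : set X)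
    (mA mB : nat) (del : R) :
  (0 < P)%N -> (P <= Q)%N -> fine_partitions rho SA mA ->
  fine_partitions rho SB mB -> closed SA -> closed SB ->
  (forall a j, SA a -> (j < Q)%N -> iter j T a = iter (j %% P) T a) ->
  (mA + mB < Q * d)%N -> 0 < del ->
  generically_separated R T d [set z | [/\ SA z.1, SB z.2 &
    forall i j : 'I_P + 'I_Q, i != j ->
      del <= rho (two_orbits i z) (two_orbits j z)]].
Proof.
move=> P0 PQ fineA fineB SAcl SBcl SAper mQ del0.
have r0 : 0 < del / 3 by rewrite divr_gt0.
apply: (@generically_separated_local _ _ _ rho_metric X_compact _ _ T_continuous
  _ (@two_orbits P Q) _ _ r0).
- rewrite (_ : [set z | _] = (fst @^-1` SA `&` snd @^-1` SB) `&`
    [set z | forall i j : 'I_P + 'I_Q, i != j ->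
      del <= rho (two_orbits i z) (two_orbits j z)]).
    apply: closedI; last exact/closed_separated/two_orbits_continuous.
    apply: closedI.
      by apply: (continuous_closedP _).1 SAcl => z; exact: cvg_fst.
    by apply: (continuous_closedP _).1 SBcl => z; exact: cvg_snd.
  by apply/seteqP; split=> z /= [] => [? ? ?|[]].
- exact: two_orbits_continuous.
move=> [x y] f eps [/= _ _ sep] fc e0.
have d3 : 3 * (del / 3) = del by rewrite mulrC divfK.
rewrite -d3 in sep.
(* Gluing multiplies the error by the number of pieces; the successor keeps the divisor positive. *)
pose N : R := #|{: 'I_P + 'I_Q}|.+1%:R.
have N0 : 0 < N by rewrite ltr0n.
have eN0 : 0 < eps / N by rewrite divr_gt0.
have [GA [Ms [GAc GAf rMs GAM]]] := polyhedral_approximation rho_metric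
  X_compact fineA (fun c => @orbit_vector_continuous P f c fc) eN0.
pose phi (j : 'I_Q) : 'I_P := Ordinal (ltn_pmod j P0).
pose L := refold R d phi.
(* The polyhedron of the short segments is carried into dimension [Q * d], which does not raise the
   ranks. *)
pose Ns := [seq << M *m homog_mx L>>%MS | M <- Ms].
have rNs M : M \in Ns -> (\rank M <= mA.+1)%N.
  move=> /mapP[M' M'Ms ->]; rewrite genmxE.
  exact: leq_trans (mxrankM_maxl _ _) (rMs _ M'Ms).
have mQ' : (mA.+1 + mB <= Q * d)%N by rewrite addSn.
have [GB [GBc GBf GBN]] := avoiding_approximation rho_metric X_compact fineB
  (fun c => @orbit_vector_continuous Q f c fc) eN0 rNs mQ'.
(* Pulling back along [Tinv] makes the value at the [i]-th iterate of a point the [i]-th block of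
   the approximation at that point. *)
pose h (l : 'I_P + 'I_Q) (k : 'I_d) (z : X) := match l with
  | inl i => GA (iter i Tinv z) 0 (mxvec_index i k)
  | inr j => GB (iter j Tinv z) 0 (mxvec_index j k) end.
have hc l k : continuous (h l k).
  by case: l => l; [exact: pullback_continuous | exact: pullback_continuous].
have [g [gc gf gh]] := glue_functions rho_metric r0 eN0 sep fc hc.
exists g; split => //.
  move=> k z; apply: le_trans (gf k z) _.
  by rewrite mulrCA ger_pMr // ler_pdivrMr // mul1r ler_nat.
move=> a b [[/= SAa SBb _] ab].
apply: contrapT => nsep.
have gab i k : g k (iter i T a) = g k (iter i T b).
  by apply: contrapT => h'; apply: nsep; exists i, k.
have gA (i : 'I_P) k : g k (iter i T a) = GA a 0 (mxvec_index i k).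
  rewrite (gh (inl i)) /h ?iterK //; first exact: (ab (inl i)).
  by rewrite -orbit_vectorE GAf.
have gB (j : 'I_Q) k : g k (iter j T b) = GB b 0 (mxvec_index j k).
  rewrite (gh (inr j)) /h ?iterK //; first exact: (ab (inr j)).
  by rewrite -orbit_vectorE GBf.
(* Without separation the segment of [b] repeats that of [a] periodically, which puts [GB b] in a
   subspace that it avoids. *)
have GBA : GB b = GA a *m L.
  rewrite -[GA a]vec_mxK -[GB b]vec_mxK mul_refold; congr mxvec.
  apply/matrixP => j k; rewrite !mxE -gB -gab -gA.
  by rewrite SAper.
have [M MMs aM] := GAM a SAa.
have /negP := GBN b << M *m homog_mx L>>%MS SBb (map_f _ MMs).
by apply; rewrite genmxE GBA homog_mul submxMr.
Qed.

(* A point on the orbit of [a] forces a coincidence inside the orbit segment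
   of [a], which then takes at most [q d] parameters. *)
Lemma generically_separated_one_orbit (P : nat) (S : set X) (m j q : nat)
    (del : R) :
  (0 < q)%N -> (q <= P)%N -> fine_partitions rho S m -> closed S ->
  (forall a (u : X -> R), S a ->
    (forall i, u (iter i T (iter j T a)) = u (iter i T a)) ->
    forall i, (i < P)%N -> u (iter i T a) = u (iter (i %% q) T a)) ->
  (q * d + m < P * d)%N -> 0 < del ->
  generically_separated R T d [set z | [/\ S z.1, z.2 = iter j T z.1 &
    forall i l : 'I_P, i != l -> del <= rho (iter i T z.1) (iter l T z.1)]].
Proof.
move=> q0 qP fineS Scl Sfold mP del0.
have r0 : 0 < del / 3 by rewrite divr_gt0.
apply: (@generically_separated_local _ _ _ rho_metric X_compact _ _ T_continuous
  _ (fun (i : 'I_P) z => iter i T z.1) _ _ r0).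
- rewrite (_ : [set z | _] = (fst @^-1` S `&` [set z | rho z.2 (iter j T z.1) <= 0])
    `&` [set z | forall i l : 'I_P, i != l -> del <= rho (iter i T z.1) (iter l T z.1)]).
    apply: closedI; last first.
      by apply: closed_separated => i; exact: iter_fst_continuous.
    apply: closedI.
      by apply: (continuous_closedP _).1 Scl => z; exact: cvg_fst.
    apply: closed_preimage_le; apply: rho_comp_continuous => //.
      by move=> z; exact: cvg_snd.
    exact: iter_fst_continuous.
  apply/seteqP; split=> z /= [].
    by move=> Sz -> sep; split => //; split => //; rewrite rho_xx.
  move=> [Sz z0] sep; split => //; apply/(rho_eq0 rho_metric).
  by apply/eqP; rewrite eq_le z0 rho_ge0.
- by move=> i; exact: iter_fst_continuous.
move=> [x y] f eps [/= _ _ sep] fc e0.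
have d3 : 3 * (del / 3) = del by rewrite mulrC divfK.
rewrite -d3 in sep.
pose N : R := #|'I_P|.+1%:R.
have N0 : 0 < N by rewrite ltr0n.
have eN0 : 0 < eps / N by rewrite divr_gt0.
pose phi (i : 'I_P) : 'I_q := Ordinal (ltn_pmod i q0).
pose L := refold R d phi.
(* In homogeneous coordinates, the segments repeating with period [q] span at most [1 + q * d]
   dimensions. *)
have rMs M : M \in [:: <<homog_mx L>>%MS] -> (\rank M <= 1 + q * d)%N.
  by rewrite mem_seq1 => /eqP ->; rewrite genmxE rank_leq_row.
have mP' : (1 + q * d + m <= P * d)%N by rewrite -addnA.
have [G [Gc Gf GN]] := avoiding_approximation rho_metric X_compact fineS
  (fun c => @orbit_vector_continuous P f c fc) eN0 rMs mP'.
pose h (i : 'I_P) (k : 'I_d) (z : X) := G (iter i Tinv z) 0 (mxvec_index i k).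
have hc i k : continuous (h i k) by exact: pullback_continuous.
have [g [gc gf gh]] := glue_functions rho_metric r0 eN0 sep fc hc.
exists g; split => //.
  move=> k z; apply: le_trans (gf k z) _.
  by rewrite mulrCA ger_pMr // ler_pdivrMr // mul1r ler_nat.
move=> a b [[/= Sa -> _] ab].
apply: contrapT => nsep.
have gab i k : g k (iter i T (iter j T a)) = g k (iter i T a).
  by apply: contrapT => h'; apply: nsep; exists i, k; apply: nesym.
have gA (i : 'I_P) k : g k (iter i T a) = G a 0 (mxvec_index i k).
  rewrite (gh i) /h ?iterK //; last by rewrite -orbit_vectorE Gf.
(* Since [a] and its [j]-th iterate have equal sequences, [Sfold] recovers the segment of [a] from
   its first [q] rows. *)
have GL : G a = mxvec (\matrix_(i < q, k < d) g k (iter i T a)) *m L.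
  rewrite mul_refold -[G a]vec_mxK; congr mxvec.
  apply/matrixP => i k; rewrite !mxE -gA.
  by rewrite (Sfold a (g k) Sa (gab^~ k)).
have /negP := GN a <<homog_mx L>>%MS Sa (mem_head _ _).
by apply; rewrite genmxE GL homog_mul submxMl.
Qed.


End orbits.

(** * From separation to an embedding *)

Lemma prod_topology_continuous (I : Type) (K : I -> topologicalType)
    (Z : topologicalType) (f : Z -> prod_topology K) :
  (forall i, continuous (fun z => f z i)) -> continuous f.
Proof.
move=> fc z; apply/cvg_sup => i.
by apply: (@continuous_comp_initial _ _ _ (@proj I K i) f).
Qed.

Lemma set_type_continuous (Y Z : topologicalType) (A : set Y) (f : Z -> set_type A) :
  continuous (fun z => set_val (f z)) -> continuous f.
Proof. exact: (@continuous_comp_initial _ _ _ set_val f). Qed.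

Lemma hausdorff_separating (R : realType) (Y : topologicalType) :
  (forall p q : Y, p <> q -> exists2 h : Y -> R, continuous h & h p <> h q) ->
  hausdorff_space Y.
Proof.
move=> sepY p q pq; apply: contrapT => /sepY[h hc]; apply.
apply: (@Rhausdorff R) => A B nA nB.
have [y [Ay By]] := pq _ _ (hc p _ nA) (hc q _ nB).
by exists (h y).
Qed.

(** The corestriction is a closed bijection: closed sets are compact, and so are their images, which
    are closed in a Hausdorff space. *)
Lemma injective_homeomorphism_onto_image (X Y : topologicalType) (phi : X -> Y) :
  compact [set: X] -> hausdorff_space (set_type (range phi)) ->
  continuous phi -> injective phi -> homeomorphism_onto_image phi.
Proof.
move=> Xco Yh phic phii.
have cc : continuous (corestriction phi) by apply: set_type_continuous.
split => //.
have /choice[g gK] (y : set_type (range phi)) : exists x, corestriction phi x = y.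
  case: y => y yP; have [x _ xy] := set_mem yP.
  by exists x; apply: val_inj.
have gK' : cancel (corestriction phi) g.
  by move=> x; apply: phii; exact: (congr1 val (gK (corestriction phi x))).
exists g; split => //; apply/continuous_closedP => C Ccl.
rewrite (_ : g @^-1` C = corestriction phi @` C).
  apply: compact_closed => //; apply: continuous_compact.
    exact: continuous_subspaceT.
  exact: subclosed_compact Ccl Xco _.
apply/seteqP; split=> [y /= Cgy|_ [x Cx <-]]; first by exists (g y).
by rewrite /= gK'.
Qed.

Section squash.
Context (R : realType).

(** Applied only at the end, this injection into the unit interval spares all perturbations from
    respecting the bounds 0 and 1. *)
Definition squash_real (t : R) : R := (1 + t / (1 + `|t|)) / 2.

Lemma squash_in (t : R) : squash_real t \in (`[0, 1]%classic : set R).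
Proof.
rewrite inE /= in_itv /=.
have t1 : 0 < 1 + `|t| by rewrite ltr_pwDl.
have : `|t / (1 + `|t|)| <= 1.
  by rewrite normrM normfV (gtr0_norm t1) ler_pdivrMr // mul1r lerDr.
rewrite ler_norml /squash_real => /andP[? ?]; apply/andP; split; lra.
Qed.

Definition squash (t : R) : set_type (`[0, 1]%classic : set R) :=
  exist _ (squash_real t) (squash_in t).

Lemma squash_inj : injective squash.
Proof.
move=> t u /(congr1 val) /= tu.
have t1 : 0 < 1 + `|t| by rewrite ltr_pwDl.
have u1 : 0 < 1 + `|u| by rewrite ltr_pwDl.
have {}tu : t / (1 + `|t|) = u / (1 + `|u|) by move: tu; rewrite /squash_real; lra.
have tu' : t * (1 + `|u|) = u * (1 + `|t|).
  by move/eqP: tu; rewrite eqr_div ?(gt_eqF t1) ?(gt_eqF u1) // => /eqP.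
have ntu : `|t| = `|u|.
  have := congr1 Num.norm tu'; rewrite !normrM (gtr0_norm t1) (gtr0_norm u1); lra.
by move: tu'; rewrite ntu => /mulIf -> //; rewrite -ntu gt_eqF.
Qed.

Lemma squash_continuous : continuous squash.
Proof.
apply: set_type_continuous => t /=.
apply: cvgMr_tmp; apply: cvgD; first exact: cvg_cst.
apply: cvgM; first exact: cvg_id.
have t1 : 0 < 1 + `|t| by rewrite ltr_pwDl.
apply: cvgV; first by rewrite gt_eqF.
by apply: cvgD; [exact: cvg_cst | exact: norm_continuous].
Qed.

End squash.

Lemma cube_sequences_coord_continuous (R : realType) (d : nat) (i : int) (k : 'I_d) :
  continuous (fun y : cube_sequences R d => set_val (y i k) : R).
Proof.
apply: (@continuous_comp_fun _ _ _ (fun y : cube_sequences R d => y i k)).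
  apply: (@continuous_comp_fun _ _ _ (fun y : cube_sequences R d => y i)
    (fun c : cube R d => c k)).
    exact: (@proj_continuous int (fun _ => cube R d) i).
  exact: (@proj_continuous 'I_d (fun _ => set_type (`[0, 1]%classic : set R)) k).
exact: initial_continuous.
Qed.

Lemma cube_sequences_sub_hausdorff (R : realType) (d : nat)
    (A : set (cube_sequences R d)) :
  hausdorff_space (set_type A).
Proof.
apply: (@hausdorff_separating R) => p q pq.
have [i [k h]] : exists i k, set_val p i k <> set_val q i k.
  apply: contrapT => h; apply/pq/val_inj/funext => i; apply/funext => k.
  by apply: contrapT => h'; apply: h; exists i, k.
exists (fun y => set_val (set_val y i k)).
  apply: (@continuous_comp_fun _ _ _ set_val
    (fun y : cube_sequences R d => set_val (y i k) : R)).
    exact: initial_continuous.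
  exact: cube_sequences_coord_continuous.
by move=> /val_inj.
Qed.

(** [Negz n] denotes [-(n + 1)], whence the successor. *)
Definition int_iter (X : Type) (T Tinv : X -> X) (i : int) : X -> X :=
  match i with Posz n => iter n T | Negz n => iter n.+1 Tinv end.

Lemma int_iterD1 (X : Type) (T Tinv : X -> X) (i : int) x : cancel T Tinv ->
  int_iter T Tinv i (T x) = int_iter T Tinv (i + 1) x.
Proof.
move=> TK; case: i => [n|[|n]].
- by rewrite -PoszD addn1 /= -iterSr.
- by rewrite /= TK.
- rewrite (_ : Negz n.+1 + 1 = Negz n); last by lia.
  by rewrite /= -!iterS iterSr TK.
Qed.

(** The coordinates with nonnegative index already distinguish points, so separation along forward
    orbits suffices. *)
Lemma embeds_of_separating (R : realType) (X : topologicalType)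
    (T Tinv : X -> X) (d : nat) (f : 'I_d -> X -> R) :
  compact [set: X] -> continuous T -> continuous Tinv -> cancel T Tinv ->
  (forall k, continuous (f k)) ->
  (forall a b, a <> b -> exists i k, f k (iter i T a) <> f k (iter i T b)) ->
  embeds T (cube_shift R d).
Proof.
move=> Xco Tc Tinvc TK fc fsep.
pose phi x : cube_sequences R d :=
  fun i k => squash (f k (int_iter T Tinv i x)).
exists phi; split.
  apply: injective_homeomorphism_onto_image => //.
  - exact: cube_sequences_sub_hausdorff.
  - apply: prod_topology_continuous => i.
    apply: prod_topology_continuous => k.
    apply: (@continuous_comp_fun _ _ _ (fun x => f k (int_iter T Tinv i x)));
      last exact: squash_continuous.
    apply: continuous_comp_fun; last exact: fc.
    by case: i => i; apply: iter_continuous.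
  - move=> a b ab; apply: contrapT => /fsep[i [k]]; apply.
    by have /squash_inj := congr1 (fun y : cube_sequences R d => y (Posz i) k) ab.
move=> x; apply/funext => i; apply/funext => k.
by rewrite /phi /cube_shift int_iterD1.
Qed.

(** * The Baire category argument *)

Section baire.
Context (R : realType) (X : topologicalType) (T : X -> X) (d : nat).

(** Nested closed balls with centres [f n] and radii [eta n] are built so that every function in
    ball [n.+1] separates [K n]; the limit lies in all of them. *)
Lemma baire_separation (K : nat -> set (X * X)) :
  (forall n, generically_separated R T d (K n)) ->
  exists2 f : 'I_d -> X -> R, forall k, continuous (f k) &
    forall n, separates T f (K n).
Proof.
move=> KG; pose state : Type := (('I_d -> X -> R) * R)%type.
pose good (s : state) := (forall k, continuous (s.1 k)) /\ 0 < s.2.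
(* Centre displacement and new radius are each at most half of the old radius, so the new ball lies
   inside the old one. *)
have /choice[F HF] (ns : nat * state) : exists s' : state, good ns.2 ->
    [/\ good s', s'.2 <= ns.2.2 / 2,
        forall k z, `|s'.1 k z - ns.2.1 k z| <= ns.2.2 / 2 &
        forall h : 'I_d -> X -> R,
          (forall k z, `|h k z - s'.1 k z| <= s'.2) -> separates T h (K ns.1)].
  case: ns => n [f eta] /=.
  have [[/= fc eta0]|ng] := pselect (good (f, eta)); last by exists (f, eta) => /ng.
  have eta20 : 0 < eta / 2 by rewrite divr_gt0.
  have [g [gc gf [eta' eta'0 H]]] := KG n f _ fc eta20.
  exists (g, Num.min eta' (eta / 2)) => _; split => //=.
  - by split => //=; rewrite lt_min eta'0.
  - by rewrite ge_min lexx orbT.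
  - move=> h hg; apply: H => k z; apply: le_trans (hg k z) _.
    by rewrite ge_min lexx.
pose s := fix s n : state := if n is n'.+1 then F (n', s n') else (fun _ _ => 0, 1).
have sgood n : good (s n).
  elim: n => [|n IH]; last by have [] := HF (n, s n) IH.
  by split => [k|]; [exact: cst_continuous | exact: ltr01].
pose f n := (s n).1; pose eta n := (s n).2.
have fc n k : continuous (f n k) by have [h _] := sgood n; exact: h.
have eta0 n : 0 < eta n by have [] := sgood n.
have etaS n : eta n.+1 <= eta n / 2 by have [] := HF (n, s n) (sgood n).
have fS n k z : `|f n.+1 k z - f n k z| <= eta n / 2.
  by have [_ _ h _] := HF (n, s n) (sgood n); exact: h.
have fsep n (h : 'I_d -> X -> R) :
    (forall k z, `|h k z - f n.+1 k z| <= eta n.+1) -> separates T h (K n).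
  by have [_ _ _ H] := HF (n, s n) (sgood n); exact: H.
have fD n m k z : `|f (n + m)%N k z - f n k z| <= eta n - eta (n + m)%N.
  elim: m => [|m IH]; first by rewrite addn0 !subrr normr0.
  rewrite addnS -(subrKA (f (n + m)%N k z)); apply: le_trans (ler_normD _ _) _.
  have := fS (n + m)%N k z; have := etaS (n + m)%N; lra.
have fle n m k z : f n k z - eta n <= f m k z + eta m.
  have [/subnK h|/ltnW/subnK h] := leqP n m.
    have := fD n (m - n)%N k z; rewrite addnC h ler_norml => /andP[? ?].
    have := eta0 m; lra.
  have := fD m (n - m)%N k z; rewrite addnC h ler_norml => /andP[? ?].
  have := eta0 n; lra.
pose A k z := range (fun n => f n k z - eta n).
(* The intervals [f n k z +- eta n] are nested, so that this is the limit. *)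
pose g k z := sup (A k z).
have gf k z n : `|g k z - f n k z| <= eta n.
  have Aub : ubound (A k z) (f n k z + eta n) by move=> _ [m _ <-].
  have A0 : A k z !=set0 by exists (f 0%N k z - eta 0%N); exists 0%N.
  have h1 : g k z <= f n k z + eta n by exact: ge_sup.
  have h2 : f n k z - eta n <= g k z.
    by apply: ub_le_sup; [exists (f n k z + eta n) | exists n].
  by rewrite ler_norml; apply/andP; split; lra.
(* The radii start at 1 and at least halve, so they tend to 0; the convergence is uniform and the
   limit continuous. *)
have eta_le n : eta n <= n.+1%:R^-1.
  elim: n => [|n IH]; first by rewrite invr1.
  apply: le_trans (etaS n) _; rewrite ler_pdivrMr //.
  apply: le_trans IH _; rewrite mulrC ler_pdivlMr ?ltr0n // mulrC.
  by rewrite ler_pdivrMr ?ltr0n // -natrM ler_nat; lia.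
exists g; last by move=> n; apply: fsep => k z; exact: gf.
move=> k x; apply/cvgrPdist_le => e e0.
pose n := Num.truncn (3 / e).
have en : eta n <= e / 3.
  apply: le_trans (eta_le n) _; rewrite -[e / 3]invrK invf_div.
  rewrite lef_pV2 ?posrE ?divr_gt0 ?ltr0n //.
  exact/ltW/truncnS_gt.
have e30 : 0 < e / 3 by rewrite divr_gt0.
have /cvgrPdist_le /(_ _ e30) := fc n k x.
apply: filterS => y; have := gf k x n; have := gf k y n.
rewrite !ler_norml => /andP[? ?] /andP[? ?] /andP[? ?].
apply/andP; split; lra.
Qed.

Lemma baire_separation_countable (I : countType) (K : I -> set (X * X)) :
  (forall i, generically_separated R T d (K i)) ->
  exists2 f : 'I_d -> X -> R, forall k, continuous (f k) &
    forall i, separates T f (K i).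
Proof.
move=> KG.
have [|f fc fK] :=
    @baire_separation (fun n => if unpickle n is Some i then K i else set0).
  by move=> n; case: unpickle => [i|]; [exact: KG | exact: generically_separated0].
by exists f => // i; have := fK (pickle i); rewrite pickleK.
Qed.

End baire.

(** * Periodicity and dimension *)

Section periodicity.
Context (X : Type) (T : X -> X).

Lemma iter_period_mul (p m : nat) x : iter p T x = x -> iter (m * p) T x = x.
Proof.
by move=> px; elim: m => // m IH; rewrite mulSn iterD IH.
Qed.

Lemma iter_modn (p j : nat) x : iter p T x = x -> iter j T x = iter (j %% p) T x.
Proof.
by move=> px; rewrite {1}(divn_eq j p) addnC iterD iter_period_mul.
Qed.

Lemma minimal_period_exists (p : nat) x : (0 < p)%N -> iter p T x = x ->
  exists2 q, (q <= p)%N & minimal_period T x q.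
Proof.
move=> p0 px; have ex : exists q, `[< (0 < q)%N /\ iter q T x = x >].
  by exists p; apply/asboolP.
case: (ex_minnP ex) => q /asboolP[q0 qx] qmin; exists q.
  by apply: qmin; apply/asboolP.
split => // j /andP[j0 jq] jx.
have /qmin : `[< (0 < j)%N /\ iter j T x = x >] by apply/asboolP.
by rewrite leqNgt jq.
Qed.

Lemma iter_injective (i : nat) : injective T -> injective (iter i T).
Proof. by move=> Tinj; elim: i => //= i IH x y /Tinj /IH. Qed.

Lemma minimal_period_inj (p : nat) x i j : injective T -> minimal_period T x p ->
  (i < p)%N -> (j < p)%N -> iter i T x = iter j T x -> i = j.
Proof.
move=> Tinj [p0 px pmin]; wlog ij : i j / (i <= j)%N.
  move=> H ip jp; case/orP: (leq_total i j) => h; first exact: H.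
  by move=> /esym e; apply/esym; apply: H.
move=> ip jp; rewrite -{1}(subnKC ij) iterD => /(@iter_injective i Tinj) /esym e.
apply/eqP; rewrite eqn_leq ij -subn_eq0; apply: contraT; rewrite -lt0n => h.
by exfalso; apply: (pmin (j - i)%N) => //; lia.
Qed.

End periodicity.

(** By Bezout some multiple of [a] exceeds a multiple of [b] by exactly the gcd, which is therefore
    a period too. *)
Lemma periodic_gcd (Y : Type) (s : nat -> Y) (a b : nat) : (0 < a)%N ->
  (forall i, s (i + a)%N = s i) -> (forall i, s (i + b)%N = s i) ->
  forall i, s i = s (i %% gcdn a b)%N.
Proof.
move=> a0 sa sb; have smul c : (forall i, s (i + c)%N = s i) ->
    forall k i, s (i + k * c)%N = s i.
  by move=> sc; elim=> [|k IH] i; rewrite ?addn0 // mulSnr addnA sc IH.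
have sg i : s (i + gcdn a b)%N = s i.
  case: (egcdnP b a0) => km kn e _.
  by rewrite -(smul b sb kn) -addnA (addnC (gcdn a b)) -e smul.
by move=> i; rewrite {1}(divn_eq i (gcdn a b)) addnC smul.
Qed.

Section strata.
Context (R : realType) (X : topologicalType) (rho : X -> X -> R).
Context (rho_metric : metric_inducing rho).
Context (X_compact : compact [set: X]).

(** Finitely many distinct points have a positive least distance; replacing it by some [m.+1%:R^-1]
    keeps the set of scales countable. *)
Lemma separated_scale (I : finType) (c : I -> X) : injective c ->
  exists m : nat, forall i j, i != j -> m.+1%:R^-1 <= rho (c i) (c j).
Proof.
move=> cinj.
pose e := \big[Num.min/1]_(ij : I * I | ij.1 != ij.2) rho (c ij.1) (c ij.2).
have e0 : 0 < e.
  apply: lt_bigmin => // -[i j] /= ij.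
  by apply: rho_gt0 => // /cinj/eqP; apply/negP.
exists (Num.truncn e^-1) => i j ij; apply: (@le_trans _ _ e).
  rewrite -[leRHS]invrK lef_pV2 ?posrE ?invr_gt0 ?ltr0n //.
  exact/ltW/truncnS_gt.
exact: (@bigmin_le_cond _ _ _ _ (i, j)).
Qed.

Lemma fine_partitions_subset (S S' : set X) (m : nat) :
  S `<=` S' -> fine_partitions rho S' m -> fine_partitions rho S m.
Proof.
move=> SS' fine del del0; have [n [phi [? ? h1 h2 h3]]] := fine del del0.
exists n, phi; split => //.
- by move=> x /SS'; exact: h1.
- by move=> x /SS'; exact: h2.
- by move=> i x y il /SS' Sx /SS' Sy; exact: h3.
Qed.

Context (T : X -> X).
Context (T_continuous : continuous T).

Lemma closed_fixed (p : nat) : closed [set x | iter p T x = x].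
Proof.
rewrite (_ : [set x | _] = [set x | rho (iter p T x) x <= 0]).
  apply: closed_preimage_le; apply: rho_comp_continuous => //.
    exact: iter_continuous.
  by move=> x; exact: cvg_id.
apply/seteqP; split=> x /=; first by move=> ->; rewrite rho_xx.
by move=> h; apply/(rho_eq0 rho_metric)/eqP; rewrite eq_le h rho_ge0.
Qed.

(** Bounding the minimal period by [k] amounts to being fixed by some positive iterate up to [k], a
    finite union of closed conditions. *)
Lemma closed_periodic_points (k : nat) : closed (periodic_points T k).
Proof.
rewrite (_ : periodic_points T k = [set x | exists2 p, (0 < p <= k)%N & iter p T x = x]).
  elim: k => [|k IH].
    rewrite (_ : [set x | _] = set0); first exact: closed0.
    by apply/seteqP; split=> // x [p]; lia.
  rewrite (_ : [set x | _] = [set x | exists2 p, (0 < p <= k)%N & iter p T x = x]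
    `|` [set x | iter k.+1 T x = x]).
    by apply: closedU => //; exact: closed_fixed.
  apply/seteqP; split=> x /=.
    move=> [p /andP[p0]]; rewrite leq_eqVlt => /orP[/eqP -> ?|pk px]; first by right.
    by left; exists p; rewrite // p0.
  move=> [[p /andP[p0 pk] px]|kx]; last by exists k.+1; rewrite // leqnn.
  by exists p; rewrite // p0 ltnW.
apply/seteqP; split=> x.
  by move=> [p pk [p0 px _]]; exists p; rewrite // p0.
move=> [p /andP[p0 pk] px]; have [q qp qx] := minimal_period_exists p0 px.
by exists q => //; exact: leq_trans pk.
Qed.

Lemma set_type_closed_map (S : set X) (C : set (set_type S)) :
  closed S -> closed C -> closed (set_val @` C).
Proof.
move=> Scl Ccl; have [W Wop WC] : open (~` C) by exact: closed_openC.
rewrite (_ : _ @` C = ~` W `&` S); first by apply: closedI => //; exact: open_closedC.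
apply/seteqP; split=> [_ [y Cy <-]|x [Wx Sx]].
  split; last exact: set_mem (valP y).
  by move=> Wy; have : (~` C) y by rewrite -WC.
exists (exist _ x (mem_set Sx)) => //.
apply: contrapT => nC; apply: Wx.
by have : (set_val @^-1` W) (exist _ x (mem_set Sx)) by rewrite WC.
Qed.

Lemma fine_partitions_periodic (k m : nat) :
  (top_dim R (set_type (periodic_points T k)) < (m.+1%:R : R)%:E)%E ->
  fine_partitions rho (periodic_points T k) m.
Proof.
move=> h; have E : periodic_points T k =
    range (set_val : set_type (periodic_points T k) -> X).
  apply/seteqP; split=> [x kx|_ [y _ <-]]; last exact: set_mem (valP y).
  by exists (exist _ x (mem_set kx)).
rewrite E; apply: (top_dim_fine_partitions rho_metric X_compact _ _ _ h).
- exact: initial_continuous.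
- exact: val_inj.
- by move=> C; apply: set_type_closed_map; exact: closed_periodic_points.
Qed.

Lemma fine_partitions_setT (m : nat) :
  (top_dim R X < (m.+1%:R : R)%:E)%E -> fine_partitions rho [set: X] m.
Proof.
move=> h; rewrite (_ : setT = range (@id X)); last by rewrite image_id.
apply: (top_dim_fine_partitions rho_metric X_compact _ _ _ h) => //.
  by move=> x; exact: cvg_id.
by move=> C; rewrite image_id.
Qed.

End strata.

(** [(p * d).-1./2] is the largest integer strictly below half of [p * d], so its successor is at
    least that half. *)
Lemma perdim_top_dim (R : realType) (X : topologicalType) (T : X -> X) (d p : nat) :
  (0 < p)%N -> (0 < d)%N -> (perdim R T < (d%:R / 2 : R)%:E)%E ->
  (top_dim R (set_type (periodic_points T p)) < (((p * d).-1./2.+1)%:R : R)%:E)%E.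
Proof.
move=> p0 d0 h.
have {h} : (top_dim R (set_type (periodic_points T p)) / (p%:R : R)%:E
    < (d%:R / 2 : R)%:E)%E.
  by apply: le_lt_trans h; apply: ereal_sup_ubound; exists p.
have p0' : 0 < p%:R :> R by rewrite ltr0n.
rewrite inver (gt_eqF p0') lte_pdivrMr // => /lt_le_trans; apply.
rewrite -EFinM lee_fin mulrAC ler_pdivrMr // -!natrM ler_nat; nia.
Qed.

(** * A countable cover of the off-diagonal pairs *)

Section families.
Context (R : realType) (X : topologicalType) (rho : X -> X -> R).
Context (T : X -> X) (d n : nat).

(* [Some p] codes the points fixed by [T^p], and [None] the whole space. *)
Definition stratum (s : option nat) : set X :=
  if s is Some p then [set x | iter p T x = x] else setT.

Definition stratum_dim (s : option nat) : nat :=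
  if s is Some p then (p * d).-1./2 else n.

Definition stratum_ok (s : option nat) : Prop := if s is Some p then (0 < p)%N else True.

(* The hypotheses of the separation lemmas are conjuncts of the next two
   families, whose members with unsuitable indices are thus empty. *)
Definition two_orbit_pairs (i : nat * nat * option nat * option nat * nat) :
    set (X * X) :=
  let '(P, Q, s, t, m) := i in
  [set z | [/\ (0 < P <= Q)%N, stratum_ok s /\ stratum_ok t,
      forall a j, stratum s a -> (j < Q)%N -> iter j T a = iter (j %% P) T a,
      (stratum_dim s + stratum_dim t < Q * d)%N &
      [/\ stratum s z.1, stratum t z.2 &
      forall i j : 'I_P + 'I_Q, i != j ->
        m.+1%:R^-1 <= rho (two_orbits T i z) (two_orbits T j z)]]].

Definition one_orbit_pairs (i : nat * option nat * nat * nat * nat) :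
    set (X * X) :=
  let '(P, s, j, q, m) := i in
  [set z | [/\ (0 < q <= P)%N, stratum_ok s,
      forall a (u : X -> R), stratum s a ->
        (forall i, u (iter i T (iter j T a)) = u (iter i T a)) ->
        forall i, (i < P)%N -> u (iter i T a) = u (iter (i %% q) T a),
      (q * d + stratum_dim s < P * d)%N &
      [/\ stratum s z.1, z.2 = iter j T z.1 &
      forall i l : 'I_P, i != l ->
        m.+1%:R^-1 <= rho (iter i T z.1) (iter l T z.1)]]].

End families.

(** Lets the side conditions built into a member of a family be read off from any of its points. *)
Lemma generically_separated_guard (R : realType) (X : topologicalType)
    (T : X -> X) (d : nat) (K L : set (X * X)) :
  K `<=` L -> (K !=set0 -> generically_separated R T d L) ->
  generically_separated R T d K.
Proof.
move=> KL HL; have [->|/set0P/HL] := eqVneq K set0.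
  exact: generically_separated0.
exact: generically_separated_subset.
Qed.

(** Every pair of distinct points lies, in one of its two orders, in a member of the countable
    family [K], hence is separated by the function that the Baire argument yields. *)
Lemma separating_function (R : realType) (X : topologicalType)
    (rho : X -> X -> R) (T Tinv : X -> X) (d n : nat) :
  metric_inducing rho -> compact [set: X] -> continuous T -> continuous Tinv ->
  cancel T Tinv -> (0 < d)%N -> fine_partitions rho setT n ->
  (forall p, (0 < p)%N ->
    fine_partitions rho [set x | iter p T x = x] (p * d).-1./2) ->
  exists2 f : 'I_d -> X -> R, forall k, continuous (f k) &
    forall a b, a <> b -> exists i k, f k (iter i T a) <> f k (iter i T b).
Proof.
move=> rhoM Xco Tc Tinvc TK d0 fineX fineP.
have Tinj : injective T by exact: can_inj TK.
have fineS s : stratum_ok s -> fine_partitions rho (stratum T s) (stratum_dim d n s).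
  by case: s => [p|_]; [exact: fineP | exact: fineX].
have closedS s : closed (stratum T s).
  by case: s => [p|]; [exact: (closed_fixed rhoM Tc) | exact: closedT].
have invm0 (m : nat) : 0 < m.+1%:R^-1 :> R by rewrite invr_gt0 ltr0n.
pose K (i : (nat * nat * option nat * option nat * nat) +
            (nat * option nat * nat * nat * nat)) : set (X * X) :=
  match i with
  | inl i => two_orbit_pairs rho T d n i
  | inr i => one_orbit_pairs rho T d n i
  end.
have [|f fc fK] := @baire_separation_countable R X T d _ K.
  case=> [[[[[P Q] s] t] m]|[[[[P s] j] q] m]].
  - apply: generically_separated_guard
        (fun z (h : K (inl (P, Q, s, t, m)) z) => let: And5 _ _ _ _ h := h in h) _.
    move=> [z [/andP[P0 PQ] [sok tok] Sper sQ _]].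
    apply: (generically_separated_two_orbits rhoM Xco Tc Tinvc TK P0 PQ
      (fineS s sok) (fineS t tok)) => //.
  - apply: generically_separated_guard
        (fun z (h : K (inr (P, s, j, q, m)) z) => let: And5 _ _ _ _ h := h in h) _.
    move=> [z [/andP[q0 qP] sok Sfold sP _]].
    exact: (generically_separated_one_orbit rhoM Xco Tc Tinvc TK q0 qP (fineS s sok)).
exists f => //.
pose sep a b := exists i k, f k (iter i T a) <> f k (iter i T b).
have sepC a b : sep a b -> sep b a.
  by move=> [i [k h]]; exists i, k; apply: nesym.
have sep2 P Q s t a b : (0 < P <= Q)%N -> stratum_ok s -> stratum_ok t ->
    (forall a j, stratum T s a -> (j < Q)%N -> iter j T a = iter (j %% P) T a) ->
    (stratum_dim d n s + stratum_dim d n t < Q * d)%N ->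
    stratum T s a -> stratum T t b ->
    (forall i j, (i < P)%N -> (j < P)%N -> iter i T a = iter j T a -> i = j) ->
    (forall i j, (i < Q)%N -> (j < Q)%N -> iter i T b = iter j T b -> i = j) ->
    (forall i j, (i < P)%N -> (j < Q)%N -> iter i T a <> iter j T b) ->
    sep a b.
  move=> PQ sok tok Sper sQ Sa Sb aa bb ab.
  have [|m Hm] := @separated_scale _ _ _ rhoM _
      (fun i : 'I_P + 'I_Q => two_orbits T i (a, b)).
    move=> [i|i] [j|j] /= e.
    - by congr inl; apply: val_inj; exact: aa e.
    - by have := ab i j (ltn_ord i) (ltn_ord j).
    - by have := ab j i (ltn_ord j) (ltn_ord i); rewrite e.
    - by congr inr; apply: val_inj; exact: bb e.
  exact: (fK (inl (P, Q, s, t, m)) a b).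
have sep1 P s j q a : (0 < q <= P)%N -> stratum_ok s ->
    (forall a (u : X -> R), stratum T s a ->
      (forall i, u (iter i T (iter j T a)) = u (iter i T a)) ->
      forall i, (i < P)%N -> u (iter i T a) = u (iter (i %% q) T a)) ->
    (q * d + stratum_dim d n s < P * d)%N -> stratum T s a ->
    (forall i j, (i < P)%N -> (j < P)%N -> iter i T a = iter j T a -> i = j) ->
    sep a (iter j T a).
  move=> qP sok Sfold sP Sa aa.
  have [|m Hm] := @separated_scale _ _ _ rhoM _ (fun i : 'I_P => iter i T a).
    by move=> i l /= e; apply: val_inj; exact: aa e.
  exact: (fK (inr (P, s, j, q, m)) a (iter j T a)).
(* The least integer above [2n], so that two copies of the space fit in general position in
   dimension [N * d]. *)
pose N := (n + n).+1.
pose short x := exists2 p, (p < N + N)%N & minimal_period T x p.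
(* A coincidence among the first [2N] iterates would give a period below [2N]. *)
have long_inj x i j : ~ short x -> (i < N + N)%N -> (j < N + N)%N ->
    iter i T x = iter j T x -> i = j.
  move=> xl; wlog ij : i j / (i <= j)%N.
    move=> H ip jp; case/orP: (leq_total i j) => h; first exact: H.
    by move=> /esym e; apply/esym; apply: H.
  move=> iN jN; rewrite -{1}(subnKC ij) iterD => /(@iter_injective _ _ i Tinj) /esym e.
  apply/eqP; rewrite eqn_leq ij -subn_eq0; apply: contraT; rewrite -lt0n => h.
  have [q qji xq] := minimal_period_exists h e.
  by exfalso; apply: xl; exists q => //; lia.
have mixed a b p : (p < N + N)%N -> minimal_period T a p -> ~ short b -> sep a b.
  move=> pN ap bl; have [p0 pa _] := ap.
  apply: (sep2 p (N + N)%N (Some p) None) => //.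
  - by rewrite p0 ltnW.
  - by move=> x j /= px _; exact: iter_modn.
  - by rewrite /= /N; nia.
  - by move=> i j; exact: minimal_period_inj.
  - by move=> i j; exact: long_inj.
  (* If the orbits met, [b] would inherit the period of [a]. *)
  - move=> i j ip jN e; apply: bl.
    have pb : iter p T b = b.
      apply: (@iter_injective _ _ j Tinj).
      by rewrite -iterD addnC iterD -e -iterD addnC iterD pa.
    have [q qp bq] := minimal_period_exists p0 pb.
    by exists q => //; exact: leq_ltn_trans pN.
have periodic a b p q : (p <= q)%N -> a <> b -> minimal_period T a p ->
    minimal_period T b q -> sep a b.
  move=> pq nab ap bq; have [p0 pa _] := ap; have [q0 qb _] := bq.
  have [[j jp bE]|nab'] := pselect (exists2 j, (j < p)%N & b = iter j T a).
    have j0 : (0 < j)%N by case: j jp bE => // _ ba; case: nab.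
    have gp := dvdn_leq j0 (dvdn_gcdl j p).
    have g0 : (0 < gcdn j p)%N by rewrite gcdn_gt0 j0.
    rewrite bE; apply: (sep1 p (Some p) j (gcdn j p)) => //.
    - by rewrite g0 (leq_trans gp) // ltnW.
    - move=> x u /= px uj i _.
      apply: (@periodic_gcd _ (fun i => u (iter i T x))) => // l.
        by rewrite iterD uj.
      by rewrite iterD px.
    (* As [j < p], the gcd is a proper divisor of [p], hence at most [p / 2]; the stratum has
       dimension strictly below [p d / 2]. *)
    - have [c cE] := dvdnP (dvdn_gcdr j p).
      have c2 : (2 <= c)%N by case: c cE => [|[|c]] //; lia.
      have : (gcdn j p * 2 <= p)%N by nia.
      rewrite /=; nia.
    - by move=> i l; exact: minimal_period_inj.
  apply: (sep2 p q (Some p) (Some q)) => //.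
  - by rewrite p0.
  - by move=> x j /= px _; exact: iter_modn.
  - rewrite /=; nia.
  - by move=> i j; exact: minimal_period_inj.
  - by move=> i j; exact: minimal_period_inj.
  (* Completing a turn around the orbit of [b] expresses [b] as an iterate of [a], reduced modulo
     [p]. *)
  - move=> i j ip jq e; apply: nab'; exists ((q - j + i) %% p)%N.
      by rewrite ltn_mod.
    by rewrite -iter_modn // iterD e -iterD subnK // ltnW.
(* A sequence of period [j] has [j * d] free parameters. Segments of length [2N] leave room, since
   [j < N] and [n < N]. *)
have aperiodic a b j : (0 < j < N)%N -> ~ short a -> b = iter j T a -> sep a b.
  move=> /andP[j0 jN] al ->; apply: (sep1 (N + N)%N None j j) => //.
  - by rewrite j0; lia.
  - move=> x u _ uj i _.
    have := @periodic_gcd _ (fun i => u (iter i T x)) j j j0.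
    rewrite gcdnn; apply=> l.
      by rewrite iterD uj.
    by rewrite iterD uj.
  - rewrite /= /N in jN *; nia.
  - by move=> i l; exact: long_inj.
move=> a b nab; rewrite -/(sep a b).
have [[p pN ap]|al] := pselect (short a); have [[q qN bq]|bl] := pselect (short b).
- have /orP[pq|qp] := leq_total p q; first exact: periodic ap bq.
  by apply: sepC; apply: periodic bq ap => //; exact: nesym.
- exact: mixed ap bl.
- by apply: sepC; exact: mixed bq al.
have [[j jN ba]|nba] := pselect (exists2 j, (0 < j < N)%N & b = iter j T a).
  exact: aperiodic ba.
have [[j jN ab]|nab'] := pselect (exists2 j, (0 < j < N)%N & a = iter j T b).
  by apply: sepC; exact: aperiodic ab.
(* Neither point is now an iterate of the other by fewer than [N] steps, so the segments of length
   [N] are disjoint. *)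
apply: (sep2 N N None None) => //.
- by rewrite leqnn.
- by move=> x j _ jN; rewrite modn_small.
- by rewrite /= /N; nia.
- by move=> i j iN jN; apply: long_inj => //; lia.
- by move=> i j iN jN; apply: long_inj => //; lia.
move=> i j iN jN e; have [ij|ij] := leqP i j.
  have ab : a = iter (j - i) T b.
    by apply: (@iter_injective _ _ i Tinj); rewrite e -iterD subnKC.
  have [ji|ji] := posnP (j - i); first by apply: nab; rewrite ab ji.
  by apply: nab'; exists (j - i)%N => //; rewrite ji; lia.
apply: nba; exists (i - j)%N; first by rewrite subn_gt0 ij; lia.
by apply: (@iter_injective _ _ j Tinj); rewrite -e -iterD subnKC // ltnW.
Qed.

Theorem mainTheorem2 (R : realType) (X : topologicalType) (n : nat)
    (T : X -> X) (d : nat)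
    (X_nonempty : [set: X] !=set0)
    (X_compact : compact [set: X])
    (X_metrizable : metrizable R X)
    (X_dim : top_dim R X = (n%:R : R)%:E)
    (T_homeo : homeomorphism T)
    (d_ge1 : (1 <= d)%N)
    (T_perdim : (perdim R T < (d%:R / 2 : R)%:E)%E) :
  embeds T (cube_shift R d).
Proof.
have [rho rhoM] := X_metrizable; have [Tc [Tinv [Tinvc TK _]]] := T_homeo.
have rhoM' : metric_inducing rho by exact: rhoM.
have [||f fc fsep] :=
    @separating_function _ _ _ _ _ d n rhoM' X_compact Tc Tinvc TK d_ge1.
- apply: fine_partitions_setT => //.
  by rewrite X_dim lte_fin ltr_nat.
(* A point fixed by [T^p] has minimal period at most [p], so the bound on [periodic_points T p]
   restricts to it. *)
- move=> p p0; apply: (@fine_partitions_subset _ _ _ _ (periodic_points T p)).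
    by move=> x px; exact: minimal_period_exists.
  apply: fine_partitions_periodic => //.
  exact: perdim_top_dim.
exact: (embeds_of_separating X_compact Tc Tinvc TK fc fsep).
Qed.
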